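(* Let $\omega$ be a modulus of continuity (not identically zero) and $X$ an isotropic $L$-space. For all $t\in[a,b]$, all non-negative $\gamma_1,\gamma_2,h_1,h_2$ such that $$\gamma_1+\gamma_2>0,\quad h_1+h_2>0,\quad [t-\gamma_1,t+\gamma_2]\subset[t-h_1,t+h_2]\subset[a,b],$$ and all $f\in\overline W^1H^\omega([a,b],X)$, $$\|\Delta^H_{\gamma_1,\gamma_2}f(t)\|_X\le K(\gamma_1,\gamma_2;h_1,h_2)\,\|\mathcal D_Hf\|_{\omega,X}+\frac2{h_1+h_2}\|f\|_{C([a,b],X)},$$ $$\|\mathcal D_Hf(t)\|_X\le\frac{I(h_1)+I(h_2)}{h_1+h_2}\,\|\mathcal D_Hf\|_{\omega,X}+\frac2{h_1+h_2}\|f\|_{C([a,b],X)}.$$ If for given $t\in[a,b]$ and $h>\gamma>0$ $$\gamma_1=\min\{\gamma,t-a\},\ \gamma_2=\min\{\gamma,b-t\},\ h_1=\min\{h,t-a\},\ h_2=\min\{h,b-t\},$$ and $\omega$ is concave, then the inequality $\|\Delta^H_{\gamma_1,\gamma_2}f(t)\|_X\le K(\gamma_1,\gamma_2;h_1,h_2)\,\|\mathcal D_Hf\|_{\omega,X}+\frac2{h_1+h_2}\|f\|_{C([a,b],X)}$ is sharp. If for $t\in[a,b]$ and $h>0$ $$h_1=\min\{h,t-a\},\ h_2=\min\{h,b-t\},$$ and $\omega$ is an arbitrary modulus of continuity, then the inequality $\|\mathcal D_Hf(t)\|_X\le\frac{I(h_1)+I(h_2)}{h_1+h_2}\,\|\mathcal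 D_Hf\|_{\omega,X}+\frac2{h_1+h_2}\|f\|_{C([a,b],X)}$ is sharp. (Sharp means: for the given $t$ and parameters there is $f\in\overline W^1H^\omega([a,b],X)$ with $\|\mathcal D_Hf\|_{\omega,X}\neq0$ for which equality holds.)
   Context: A modulus of continuity is a non-decreasing continuous semi-additive function $\omega\colon[0,\infty)\to[0,\infty)$ (i.e. $\omega(s+t)\le\omega(s)+\omega(t)$) with $\omega(0)=0$. $I(\alpha)=\int_0^\alpha\omega(s)\,ds$, and $$K(\gamma_1,\gamma_2;h_1,h_2)=\frac{(h_1-\gamma_1)+(h_2-\gamma_2)}{(h_1+h_2)^2}\left\{I\left(\tfrac{(h_1+h_2)(h_1-\gamma_1)}{(h_1-\gamma_1)+(h_2-\gamma_2)}\right)+I\left(\tfrac{(h_1+h_2)(h_2-\gamma_2)}{(h_1-\gamma_1)+(h_2-\gamma_2)}\right)\right\}$$ (understood as $0$ if $h_1=\gamma_1$ and $h_2=\gamma_2$). A semilinear space is a set $X$ with addition and multiplication by real numbers such that for all $x,y,z\in X$, $\alpha,\beta\in\mathbb R$: $x+y=y+x$; $x+(y+z)=(x+y)+z$; there is $\theta\in X$ with $x+\theta=x$ for all $x$; $\alpha(x+y)=\alpha x+\alpha y$; $\alpha(\beta x)=(\alpha\beta)x$; $1\cdot x=x$, $0\cdot x=\theta$. An $L$-space is a semilinear space $X$ with a complete separable metric $h_X$ such that $h_X(\alpha x,\alpha y)=|\alpha|h_X(x,y)$ and $h_X(x+z,y+z)\le h_X(x,y)$; it is isotropic if the last inequality is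 always an equality. An element $x$ is convex if $(\alpha+\beta)x=\alpha x+\beta x$ for all $\alpha,\beta\ge0$; $X^{\rm c}$ is the set of convex elements. An element $x$ is invertible if there is $x'\in X$ with $x+x'=\theta$; $X^{\rm inv}$ is the set of invertible elements. Standing assumption: $X^{\rm inv}\cap X^{\rm c}\ne\{\theta\}$. $X$ is equipped with a fixed convexifying operator $P$: a surjection $P\colon X\to X^{\rm c}$ with $h_X(P(x),P(y))\le h_X(x,y)$, $P\circ P=P$, $P(\alpha x+\beta y)=\alpha P(x)+\beta P(y)$ for all $x,y\in X$, $\alpha,\beta\in\mathbb R$. Integral: for a simple mapping $f$ taking values $f_1,\dots,f_n$ on pairwise disjoint measurable sets $T_1,\dots,T_n$, $\int f(s)\,ds:=\sum_iP(f_i)\mu(T_i)$ ($\mu$ the Lebesgue measure); for a uniform limit $f$ of simple mappings $f^k$ (in particular for continuous $f$), $\int f:=\lim_k\int f^k$. Hukuhara type difference: $z=x-_Hy$ means $x=y+z$ (unique, if it exists, in an isotropic space). $f$ has Hukuhara type derivative $\mathcal D_Hf(t)$ at $t\in(a,b)$ if for all small $\gamma>0$ the differences $f(t+\gamma)-_Hf(t)$, $f(t)-_Hf(t-\gamma)$ exist and the limits as $\gamma\to+0$ of $\gamma^{-1}(f(t+\gamma)-_Hf(t))$ and $\gamma^{-1}(f(t)-_Hf(t-\gamma))$ exist and coincide; $\mathcal D_Hf(t)$ is the common limit (one-sided at $t=a,b$). Divided difference: $\Delta^H_{\gamma_1,\gamma_2}f(t)=\frac{1}{\gamma_1+\gamma_2}\bigl(f(t+\gamma_2)-_Hf(t-\gamma_1)\bigr)$.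 $H^\omega([a,b],X)$ is the class of $f\colon[a,b]\to X$ with $h_X(f(t'),f(t''))\le\omega(|t'-t''|)$ for all $t',t''\in[a,b]$. $W^1H^\omega([a,b],X)$ is the class of functions $f(t)=x+\int_a^t\phi(s)\,ds$ with $\phi\in H^\omega([a,b],X)$, $x\in X^{\rm c}$; for such $f$, $\mathcal D_Hf=P(\phi)$. $\overline W^1H^\omega([a,b],X)=\bigcup_{k>0}k\cdot W^1H^\omega([a,b],X)$. Notation: $\|x\|_X=h_X(x,\theta)$, $\|f\|_{\omega,X}=\sup_{t'\ne t''\in[a,b]}\frac{h_X(f(t'),f(t''))}{\omega(|t'-t''|)}$, $\|f\|_{C([a,b],X)}=\sup_{t\in[a,b]}\|f(t)\|_X$. *)

(* Defs.v *)
From HB Require Import structures.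
From mathcomp Require Import all_boot all_order all_algebra.
From mathcomp Require Import all_classical all_reals all_analysis.

Set Implicit Arguments.
Unset Strict Implicit.
Unset Printing Implicit Defensive.
Import Order.TTheory GRing.Theory Num.Theory.
Import numFieldNormedType.Exports.

Local Open Scope classical_set_scope.
Local Open Scope ring_scope.

HB.mixin Record isSemilinear (R : realType) X := {
  sadd : X -> X -> X ;
  theta : X ;
  sscale : R -> X -> X ;
  saddC : commutative sadd ;
  saddA : associative sadd ;
  saddx0 : right_id theta sadd ;
  sscaleDr : forall a x y, sscale a (sadd x y) = sadd (sscale a x) (sscale a y) ;
  sscaleA : forall a b x, sscale a (sscale b x) = sscale (a * b) x ;
  sscale1 : forall x, sscale 1 x = x ;
  sscale0 : forall x, sscale 0 x = theta
}.

(* The scalar action need not distribute over the addition of scalars, so this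
   is not one of the (semi)modules of the library; and the library has no join
   of its additive monoids with its metric spaces, hence the operations of its
   own. *)
#[short(type="semilinearType")]
HB.structure Definition Semilinear (R : realType) := { X of isSemilinear R X }.

Arguments theta {R s}.
Notation "x <+> y" := (sadd x y) (at level 50, left associativity) : ring_scope.
Notation "a **: x" := (sscale a x) (at level 40, left associativity) :
  ring_scope.

Section SemilinearMonoid.
Context {R : realType} {X : semilinearType R}.

Let theta_left_id : left_id (theta : X) sadd.
Proof. by move=> x; rewrite saddC saddx0. Qed.

HB.instance Definition _ :=
  Monoid.isComLaw.Build X theta sadd saddA saddC theta_left_id.

End SemilinearMonoid.

HB.mixin Record Semilinear_isLSpace (R : realType) X
    & Semilinear R X & CompletePseudoMetric R X & Metric R X := {
  lspace_separable : exists D : set X, countable D /\ dense D ;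
  mdist_sscale : forall (a : R) (x y : X),
    mdist (a **: x) (a **: y) = `|a| * mdist x y ;
  mdist_sadd_le : forall x y z : X, mdist (x <+> z) (y <+> z) <= mdist x y
}.

#[short(type="lspaceType")]
HB.structure Definition LSpace (R : realType) :=
  { X of Semilinear R X & CompletePseudoMetric R X & Metric R X
       & Semilinear_isLSpace R X }.

Section LSpaces.
Context {R : realType} {X : lspaceType R}.
Implicit Types (x y z : X) (f g phi : R -> X) (w : R -> R) (P : X -> X).

Definition lnorm x : R := mdist x theta.

Definition convex_elements : set X :=
  [set x | forall a b : R, 0 <= a -> 0 <= b ->
     (a + b) **: x = a **: x <+> b **: x].

Definition invertible_elements : set X := [set x | exists x', x <+> x' = theta].

Record convexifying P : Prop := {
  convexifying_range : range P = convex_elements ;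
  convexifying_le : forall x y, mdist (P x) (P y) <= mdist x y ;
  convexifying_idem : forall x, P (P x) = P x ;
  convexifying_linear : forall (a b : R) x y,
    P (a **: x <+> b **: y) = a **: P x <+> b **: P y
}.

Definition simple_integral P (D : set R) g (v : X) : Prop :=
  exists (n : nat) (T : 'I_n -> set R) (c : 'I_n -> X),
    [/\ forall i, measurable (T i),
        trivIset setT T,
        \bigcup_i T i = D,
        forall i s, T i s -> g s = c i
      & v = \big[sadd/theta]_(i < n) (fine (lebesgue_measure (T i)) **: P (c i))].

Definition is_integral P (D : set R) f (v : X) : Prop :=
  exists (g : nat -> R -> X) (u : nat -> X),
    [/\ forall k, simple_integral P D (g k) (u k),
        {uniform D, g @ \oo --> f}
      & u @ \oo --> v].

(* The limit does not depend on the approximating simple mappings when D has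
   finite measure; theta is the value at mappings that have no integral. *)
Definition lintegral P (D : set R) f : X :=
  xget theta [set v | is_integral P D f v].

Definition hdiff_exists x y : Prop := exists z, x = y <+> z.

Definition hdiff x y : X := xget theta [set z | x = y <+> z].

Definition right_hderiv f (t : R) (l : X) : Prop :=
  (\forall c \near 0^'+, hdiff_exists (f (t + c)) (f t)) /\
  c^-1 **: hdiff (f (t + c)) (f t) @[c --> 0^'+] --> l.

Definition left_hderiv f (t : R) (l : X) : Prop :=
  (\forall c \near 0^'+, hdiff_exists (f t) (f (t - c))) /\
  c^-1 **: hdiff (f t) (f (t - c)) @[c --> 0^'+] --> l.

(* Two-sided for t inside [a, b], one-sided at the end points. *)
Definition is_hderiv (a b : R) f (t : R) (l : X) : Prop :=
  (t < b -> right_hderiv f t l) /\ (a < t -> left_hderiv f t l).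

Definition hderivable (a b : R) f : Prop :=
  forall t, t \in `[a, b] -> exists l, is_hderiv a b f t l.

Definition hderiv (a b : R) f (t : R) : X :=
  xget theta [set l | is_hderiv a b f t l].

Definition divided_diff (c1 c2 : R) f (t : R) : X :=
  (c1 + c2)^-1 **: hdiff (f (t + c2)) (f (t - c1)).

(* Elements of a class of mappings on [a, b] are represented by mappings
   R -> X whose values outside [a, b] are irrelevant. *)
Definition Hclass w (a b : R) : set (R -> X) :=
  [set f | forall s t, s \in `[a, b] -> t \in `[a, b] ->
     mdist (f s) (f t) <= w `|s - t|].

Definition W1Hclass P w (a b : R) : set (R -> X) :=
  [set f | exists x phi, [/\ convex_elements x, Hclass w a b phi &
     forall t, t \in `[a, b] -> f t = x <+> lintegral P `[a, t] phi]].

Definition W1Hcone P w (a b : R) : set (R -> X) :=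
  [set f | exists (k : R) g, [/\ 0 < k, W1Hclass P w a b g &
     forall t, t \in `[a, b] -> f t = k **: g t]].

(* The real supremum is meaningful for both norms when f is in W1Hcone P w a b:
   f is bounded and the quotients formed with its derivative are bounded. *)
Definition omega_norm w (a b : R) f : R :=
  sup [set r | exists s t, [/\ s \in `[a, b], t \in `[a, b], s != t &
     r = mdist (f s) (f t) / w `|s - t|]].

Definition C_norm (a b : R) f : R := sup [set lnorm (f t) | t in `[a, b]].

End LSpaces.

Arguments convex_elements {R} X.
Arguments invertible_elements {R} X.

Definition isotropic (R : realType) (X : lspaceType R) : Prop :=
  forall x y z : X, mdist (x <+> z) (y <+> z) = mdist x y.

Section Moduli.
Context {R : realType}.
Implicit Types w : R -> R.

(* A function on [0, +oo[ is represented by w : R -> R whose values at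
   negative reals are irrelevant. *)
Record modulus_of_continuity w : Prop := {
  modulus_ge0 : forall s, 0 <= s -> 0 <= w s ;
  modulus_homo : forall s t, 0 <= s -> s <= t -> w s <= w t ;
  modulus_continuous : {within `[0, +oo[, continuous w} ;
  modulus_subadditive : forall s t, 0 <= s -> 0 <= t ->
    w (s + t) <= w s + w t ;
  modulus0 : w 0 = 0
}.

Definition concave_on_nonneg w : Prop :=
  forall s t l : R, 0 <= s -> 0 <= t -> 0 <= l <= 1 ->
    l * w s + (1 - l) * w t <= w (l * s + (1 - l) * t).

Definition Iw w (alpha : R) : R :=
  \int[lebesgue_measure]_(s in `[0, alpha]) w s.

(* At h1 = c1, h2 = c2 this is 0, as required, because r is then 0. *)
Definition Kw w (c1 c2 h1 h2 : R) : R :=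
  let r := (h1 - c1) + (h2 - c2) in
  r / (h1 + h2) ^+ 2 *
    (Iw w ((h1 + h2) * (h1 - c1) / r) + Iw w ((h1 + h2) * (h2 - c2) / r)).

End Moduli.

(* Main.v *)
(* A function f of the class satisfies f(v) = f(u) + int_u^v psi with psi convex
   valued, psi = D_H f. The mean of psi over [t - g1, t + g2] is compared with
   its mean over [t - h1, t + h2] by moving only the excess mass: with
   r = (h1 - g1) + (h2 - g2) and G = g1 + g2, the point t - g1 - u is matched
   with t - g1 + u G / r, and symmetrically on the right, which costs exactly
   K * omega_norm. The mean over the large interval is a difference of two
   values of f, hence the term with the C-norm. The inequality for D_H f(t) is
   the same argument with the small interval shrunk to t.

   Integrals are compared by moving the end points continuously: a function
   whose increments are at most (y - x) e(y - x) with e -> 0 does not increase.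

   For sharpness, an invertible convex element of norm 1 embeds the real line
   isometrically in X. The real extremal derivatives vanish outside the large
   interval, so that F is monotone with C-norm half its total increment, and
   they increase by exactly omega(distance) along the matching above. Only
   "at least" has to be checked: the inequalities give the converse. *)

Require Import Defs.
From HB Require Import structures.
From mathcomp Require Import all_boot all_order all_algebra.
From mathcomp Require Import all_classical all_reals all_analysis.
From mathcomp Require Import ring lra.

Set Implicit Arguments.
Unset Strict Implicit.
Unset Printing Implicit Defensive.
Import Order.TTheory GRing.Theory Num.Theory.
Import numFieldNormedType.Exports.

Local Open Scope classical_set_scope.
Local Open Scope ring_scope.

(** * L-spaces and convexifying operators *)

(** The arguments of I in K come from the matching: with c = G / r and H = h1 + h2, the matched
    points q - u and q + c u are (1 + c) u = (H / r) u apart, and integrating omega((H / r) u) over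
    0 <= u <= al gives (r / H) I(H al / r).

    The obstacle is that X has no subtraction and that scalars add up only on convex elements. Means
    are therefore never subtracted: the mass they share is split off by convexity and cancelled by
    isotropy. In place of a change of variables under the X-valued integral, a matching becomes two
    rays leaving one point with different velocities; both are primitives in the same parameter u,
    and their distance is bounded through the increments of a real function.

    Concavity serves the extremal function of the divided difference: the gain omega((1 + c) u) of a
    matched pair is shared between its two points, at distances u and c u from the centre of
    reflection, in the ratio 1 : c, and concavity keeps the result within the modulus omega. For the
    derivative one point of each pair is t itself, and omega(h) - omega(|s - t|) stays within the
    modulus by subadditivity and monotonicity. *)

Section LSpaceTheory.
Context {R : realType} {X : lspaceType R}.
Implicit Types (x y z : X) (P : X -> X).

Lemma sadd0x x : theta <+> x = x.
Proof. by rewrite saddC saddx0. Qed.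

Lemma sscale_theta (c : R) : c **: theta = theta :> X.
Proof. by rewrite -(sscale0 (theta : X)) sscaleA mulr0. Qed.

Lemma mdistC x y : mdist x y = mdist y x.
Proof. exact: metric_sym. Qed.

Lemma mdist_sadd x x' y y' :
  mdist (x <+> y) (x' <+> y') <= mdist x x' + mdist y y'.
Proof.
apply: (le_trans (metric_triangle _ (x' <+> y) _)).
by rewrite lerD ?mdist_sadd_le// ![x' <+> _]saddC mdist_sadd_le.
Qed.

Lemma mdist_pscale (c : R) x y :
  0 <= c -> mdist (c **: x) (c **: y) = c * mdist x y.
Proof. by move=> c0; rewrite mdist_sscale ger0_norm. Qed.

Lemma mdist_sum (I : Type) (s : seq I) (f g : I -> X) :
  mdist (\big[sadd/theta]_(i <- s) f i) (\big[sadd/theta]_(i <- s) g i) <=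
  \sum_(i <- s) mdist (f i) (g i).
Proof.
elim/big_rec3: _ => [|i r x y _ IH]; first by rewrite mdistxx.
by rewrite (le_trans (mdist_sadd _ _ _ _))// lerD2l.
Qed.

Lemma lnorm_ge0 x : 0 <= lnorm x. Proof. exact: mdist_ge0. Qed.

Lemma lnorm_sadd x y : lnorm (x <+> y) <= lnorm x + lnorm y.
Proof. by rewrite /lnorm -{1}(saddx0 (theta : X)) mdist_sadd. Qed.

Lemma lnorm_scale (c : R) x : 0 <= c -> lnorm (c **: x) = c * lnorm x.
Proof. by move=> c0; rewrite /lnorm -{1}(sscale_theta c) mdist_pscale. Qed.

Lemma lnorm_le x y : lnorm x <= mdist x y + lnorm y.
Proof. exact: metric_triangle. Qed.

Lemma convex_sumr (I : Type) (s : seq I) (c : I -> R) x :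
  convex_elements X x -> (forall i, 0 <= c i) ->
  (\sum_(i <- s) c i) **: x = \big[sadd/theta]_(i <- s) (c i **: x).
Proof.
move=> cx c0; elim: s => [|i s IH]; first by rewrite !big_nil sscale0.
by rewrite !big_cons cx ?IH// sumr_ge0.
Qed.

Section Isotropic.
Hypothesis isoX : isotropic X.

Lemma sadd_cancel x y z : x <+> z = y <+> z -> x = y.
Proof.
by move=> e; apply: mdist_positivity; rewrite -(isoX x y z) e mdistxx.
Qed.

Lemma hdiffE x y z : x = y <+> z -> hdiff x y = z.
Proof.
move=> e; rewrite /hdiff; case: xgetP => [t _ /= et|/(_ z)//].
by apply: (@sadd_cancel _ _ y); rewrite saddC -et e saddC.
Qed.

Lemma mdist_hdiff x y z : x = y <+> z -> mdist x y = lnorm z.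
Proof.
by move=> ->; rewrite /lnorm -(isoX z theta y) sadd0x saddC.
Qed.

End Isotropic.

Section Convexifying.
Variable P : X -> X.
Hypothesis convP : convexifying P.

(** Turns convexity into an equation, so that closure under sums, scalings and limits follows from
    the linearity and continuity of P. *)
Lemma convexifying_fix x : convex_elements X x <-> P x = x.
Proof.
rewrite -(convexifying_range convP); split=> [[y _ <-]|<-].
  exact: (convexifying_idem convP).
by exists x.
Qed.

Lemma convexifying_convex x : convex_elements X (P x).
Proof. by apply/convexifying_fix/(convexifying_idem convP). Qed.

Lemma convexifyingD x y : P (x <+> y) = P x <+> P y.
Proof. by have := convexifying_linear convP 1 1 x y; rewrite !sscale1. Qed.

Lemma convexifyingZ (c : R) x : P (c **: x) = c **: P x.
Proof.
have := convexifying_linear convP c 0 x x.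
by rewrite !sscale0 !saddx0.
Qed.

Lemma convexD x y : convex_elements X x -> convex_elements X y ->
  convex_elements X (x <+> y).
Proof. by rewrite !convexifying_fix => {2}<- {2}<-; rewrite convexifyingD. Qed.

Lemma convexZ (c : R) x : convex_elements X x -> convex_elements X (c **: x).
Proof. by rewrite !convexifying_fix => {2}<-; rewrite convexifyingZ. Qed.

Lemma convex_theta : convex_elements X theta.
Proof. by move=> c d _ _; rewrite !sscale_theta saddx0. Qed.

Lemma convex_sum (I : Type) (s : seq I) (f : I -> X) :
  (forall i, convex_elements X (f i)) ->
  convex_elements X (\big[sadd/theta]_(i <- s) f i).
Proof.
by move=> cf; elim/big_ind : _ => // [|x y];
  [exact: convex_theta|exact: convexD].
Qed.

Lemma convex_cvg (T : Type) (F : set_system T) {FF : ProperFilter F}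
    (u : T -> X) l :
  (forall n, convex_elements X (u n)) -> u @ F --> l -> convex_elements X l.
Proof.
move=> cu /metricType_numDomainType.cvgrPdist_lt ul; apply/convexifying_fix;
  apply: mdist_positivity.
apply/eqP; rewrite eq_le mdist_ge0 andbT; apply/ler_addgt0Pl => e e0.
have [n /ltW ln] := filter_ex (ul _ (divr_gt0 e0 (ltr0n R 2))).
have /convexifying_fix Pu := cu n.
rewrite addr0 (le_trans (metric_triangle _ (u n) _))// [e]splitr lerD//.
  by rewrite -{1}Pu (le_trans (convexifying_le convP _ _)).
by rewrite mdistC.
Qed.

End Convexifying.

End LSpaceTheory.

(** * Functions with small increments *)

Section SmallIncrements.
Context {R : realType}.

(** Over n + 1 equal steps of length c the errors add up to (v - u) e(c), which is arbitrarily small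
    for large n. *)
Lemma small_increments (D e : R -> R) (u v : R) :
  e x @[x --> 0^'+] --> 0 ->
  (forall x y, u <= x -> x < y -> y <= v -> D y - D x <= (y - x) * e (y - x)) ->
  u <= v -> D v <= D u.
Proof.
move=> e0 De; rewrite le_eqVlt => /predU1P[->//|uv].
rewrite -subr_le0; apply/ler_addgt0Pl => eps eps0; rewrite addr0.
have vu : 0 < v - u by rewrite subr_gt0.
have eps'0 : 0 < eps / (v - u) by rewrite divr_gt0.
have /cvgrPdist_le/(_ _ eps'0) := e0.
move=> -[/= d d0 ed].
have [n nd] : exists n, (v - u) / n.+1%:R < d.
  exists (Num.truncn ((v - u) / d)).
  rewrite ltr_pdivrMr ?ltr0n// mulrC -ltr_pdivrMr//.
  exact: truncnS_gt.
set c := (v - u) / n.+1%:R in nd.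
have c0 : 0 < c by rewrite divr_gt0 ?ltr0n.
have ec : e c <= eps / (v - u).
  have := ed c; rewrite /ball/= sub0r normrN gtr0_norm// => /(_ nd c0).
  rewrite sub0r normrN; exact/le_trans/ler_norm.
have nc : u + n.+1%:R * c = v by rewrite mulrC divfK ?pnatr_eq0// addrC subrK.
have step k : (k <= n.+1)%N ->
    D (u + k%:R * c) - D u <= k%:R * c * (eps / (v - u)).
  elim: k => [_|k IH kn]; first by rewrite !mul0r addr0 subrr.
  have := IH (ltnW kn).
  have := De (u + k%:R * c) (u + k.+1%:R * c).
  rewrite lerDl mulr_ge0 ?ler0n ?(ltW c0)// ltrD2l ltr_pM2r// ltr_nat.
  rewrite -{1}nc lerD2l ler_pM2r// ler_nat => /(_ isT (ltnSn k) kn).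
  have -> : u + k.+1%:R * c - (u + k%:R * c) = c by rewrite -natr1; ring.
  have : c * e c <= c * (eps / (v - u)) by rewrite ler_pM2l.
  rewrite -natr1; lra.
have := step _ (leqnn _); rewrite nc => /le_trans; apply.
have -> : n.+1%:R * c = v - u by rewrite -nc; ring.
by rewrite mulrCA divff ?mulr1// gt_eqF.
Qed.

End SmallIncrements.

(** * Moduli of continuity *)

Lemma cvg_right0_scale (R : realType) (e : R -> R) (k : R) : 0 < k ->
  e x @[x --> 0^'+] --> 0 -> e (k * x) @[x --> 0^'+] --> 0.
Proof.
move=> k0 e_cvg0; apply/cvgrPdist_lt => eps eps0.
have /cvgrPdist_lt/(_ _ eps0)[/= d d0 ed] := e_cvg0.
exists (d / k) => /=; first by rewrite divr_gt0.
move=> x; rewrite /ball/= sub0r normrN => xd x0.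
apply: ed; last by rewrite /= mulr_gt0.
by rewrite /= sub0r normrN normrM (gtr0_norm k0) mulrC -ltr_pdivlMr.
Qed.

Section ModulusTheory.
Context {R : realType}.
Variable w : R -> R.
Hypothesis modw : modulus_of_continuity w.

Lemma modulus_cvg0 : w x @[x --> 0^'+] --> 0.
Proof.
have [_] := (continuous_within_itvcyP 0 w).1 (modulus_continuous modw).
by rewrite (modulus0 modw).
Qed.

Lemma modulus_scale_cvg0 (k c : R) :
  0 <= c -> k * w (c * x) @[x --> 0^'+] --> 0.
Proof.
rewrite le_eqVlt => /predU1P[<-|c0].
  by under eq_fun do rewrite mul0r (modulus0 modw) mulr0; exact: cvg_cst.
by have := cvgMl_tmp (a := k) (cvg_right0_scale c0 modulus_cvg0);
  rewrite mulr0; exact.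
Qed.

(** Subadditivity applied to s = (s - t) + t. A modulus thus obeys itself, which lets [w] composed
    with a distance serve as an extremal derivative. *)
Lemma modulus_dist (s t : R) : 0 <= s -> 0 <= t -> `|w s - w t| <= w `|s - t|.
Proof.
wlog ts : s t / t <= s => [H s0 t0|s0 t0].
  by have [/H|/ltW/H] := leP t s; [|rewrite distrC [`|t - s|]distrC]; apply.
rewrite !ger0_norm ?subr_ge0//; last exact: modulus_homo.
rewrite lerBlDr -{1}(subrK t s).
by rewrite modulus_subadditive// subr_ge0.
Qed.

Lemma modulus_comp_dist (p q : R) (s t : R) :
  `|p - q| <= `|s - t| -> `|w `|p| - w `|q| | <= w `|s - t|.
Proof.
move=> pq; rewrite (le_trans (modulus_dist _ _))// modulus_homo//.
by rewrite (le_trans _ pq)// ler_dist_dist.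
Qed.

(** A zero at s > 0 spreads to all multiples of s by subadditivity, and then everywhere by
    monotonicity. It makes the denominators in [omega_norm] positive. *)
Lemma modulus_gt0 (s : R) : (exists2 s, 0 <= s & w s != 0) -> 0 < s -> 0 < w s.
Proof.
move=> [u u0 wu] s0; rewrite lt_neqAle modulus_ge0 ?(ltW s0)// andbT eq_sym.
apply/eqP => ws; move/eqP : wu; apply.
have wn n : w (n%:R * s) = 0.
  elim: n => [|n IH]; first by rewrite mul0r (modulus0 modw).
  apply/le_anti; rewrite modulus_ge0 ?andbT ?mulr_ge0 ?ler0n ?(ltW s0)//.
  rewrite -natr1 mulrDl mul1r (le_trans (modulus_subadditive modw _ _))//.
  - by rewrite mulr_ge0 ?(ltW s0).
  - exact: ltW.
  - by rewrite IH ws addr0.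
apply/le_anti; rewrite modulus_ge0// andbT.
rewrite -(wn (Num.truncn (u / s)).+1) modulus_homo//.
by rewrite -ler_pdivrMr// ltW// truncnS_gt.
Qed.

Lemma modulus_bound_continuous (phi : R -> R) :
  (forall s t, `|phi s - phi t| <= w `|s - t|) -> continuous phi.
Proof.
move=> phiw t; apply/cvgrPdist_lt => e e0.
have /cvgrPdist_lt/(_ _ e0)[/= d d0 wd] := modulus_cvg0.
exists d => //= s st; apply: le_lt_trans (phiw t s) _.
have [->|ts] := eqVneq t s; first by rewrite subrr normr0 (modulus0 modw).
have {wd} := wd `|t - s|.
rewrite /ball/= sub0r normrN normr_id => /(_ st).
rewrite normr_gt0 subr_eq0 ts => /(_ isT).
by rewrite sub0r normrN; exact/le_lt_trans/ler_norm.
Qed.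

End ModulusTheory.

(** * Real primitives and the function I *)

Section Primitive.
Context {R : realType}.
Implicit Types (phi : R -> R).

Lemma Rintegral_increment phi (c u v : R) :
  continuous phi -> c <= u -> u <= v ->
  \int[lebesgue_measure]_(s in `[c, v]) phi s -
  \int[lebesgue_measure]_(s in `[c, u]) phi s =
  \int[lebesgue_measure]_(s in `]u, v]) phi s.
Proof.
move=> cphi cu uv; rewrite Rintegral_itvB ?bnd_simp//.
apply: continuous_compact_integrable; first exact: segment_compact.
exact: continuous_subspaceT.
Qed.

Lemma Rintegral_bounds phi (u v m M : R) : continuous phi -> u <= v ->
  (forall s, u <= s <= v -> m <= phi s <= M) ->
  (v - u) * m <= \int[lebesgue_measure]_(s in `]u, v]) phi s <= (v - u) * M.
Proof.
move=> cphi uv mM.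
have mu_uv : fine (lebesgue_measure (`]u, v] : set R)) = v - u.
  rewrite lebesgue_measure_itv/= lte_fin.
  by move: uv; rewrite le_eqVlt => /predU1P[->|->]//=; rewrite ltxx subrr.
have iphi (f : R -> R) : continuous f ->
    lebesgue_measure.-integrable `]u, v] (EFin \o f).
  move=> cf; have icc : lebesgue_measure.-integrable `[u, v] (EFin \o f).
    apply: continuous_compact_integrable; first exact: segment_compact.
    exact: continuous_subspaceT.
  by apply: integrableS icc => //; exact: subset_itv_oc_cc.
have H c : (v - u) * c = \int[lebesgue_measure]_(s in `]u, v]) c.
  by rewrite Rintegral_cst ?mu_uv 1?mulrC.
apply/andP; split; rewrite H; apply: le_Rintegral => //;
  try (by apply: iphi => //; exact: cst_continuous);
  by move=> s; rewrite /= in_itv/= => /andP[/ltW us sv];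
     have /mM/andP[] : u <= s <= v by rewrite us sv.
Qed.

Section Iw.
Variable w : R -> R.
Hypothesis modw : modulus_of_continuity w.

(** The values of [w] at negative reals are arbitrary, whereas w(|s|) is continuous on the whole
    line, as the integral estimates above demand. *)
Lemma Iw_abs (c : R) :
  Iw w c = \int[lebesgue_measure]_(s in `[0, c]) w `|s|.
Proof.
apply: eq_Rintegral => s; rewrite inE/= in_itv/= => /andP[s0 _].
by rewrite ger0_norm.
Qed.

(** Together with I(0) = 0 these bounds are all that is used of I: the lower one in the
    inequalities, the upper one for sharpness. *)
Lemma Iw_increment (u v : R) : 0 <= u -> u <= v ->
  (v - u) * w u <= Iw w v - Iw w u <= (v - u) * w v.
Proof.
move=> u0 uv; rewrite !Iw_abs.
have cw : continuous (fun s : R => w `|s|).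
  apply: (modulus_bound_continuous modw) => s t.
  exact: modulus_comp_dist.
rewrite Rintegral_increment//; apply: Rintegral_bounds => // s /andP[us sv].
rewrite ger0_norm ?(le_trans u0)//.
by rewrite !modulus_homo// (le_trans u0).
Qed.

Lemma Iw0 : Iw w 0 = 0.
Proof. by rewrite /Iw set_itv1 Rintegral_set1. Qed.

Lemma Iw_ge0 (u : R) : 0 <= u -> 0 <= Iw w u.
Proof.
move=> u0; have /andP[+ _] := Iw_increment (lexx 0) u0.
by rewrite (modulus0 modw) mulr0 Iw0 subr0.
Qed.

End Iw.

End Primitive.

(** * The integral *)

Section UniformDistance.
Context {R : realType} {X : lspaceType R}.

Lemma uniform_mdistP (D : set R) (g : nat -> R -> X) (f : R -> X) :
  {uniform D, g @ \oo --> f} <->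
  forall eps, 0 < eps ->
    \forall n \near \oo, forall s, D s -> mdist (f s) (g n s) < eps.
Proof.
split=> [gf eps eps0|gf A /uniform_nbhs[E [/= entE EA]]].
  have : nbhs (f : {uniform` D -> X})
      [set h | forall s, D s -> ball (f s) eps (h s)].
    apply/uniform_nbhs; exists [set xy | ball xy.1 eps xy.2]; split => //.
    exact: (entourage_ball X (PosNum eps0)).
  by move=> /gf[N _ gN]; exists N => // n /gN/= h s /h; rewrite ballEmdist.
move: entE; rewrite -(@entourage_from_ballE R) => -[e /= e0 eE].
have [N _ gN] := gf _ e0; exists N => // n /gN/= h; apply: EA => s Ds /=.
by apply: eE => /=; rewrite ballEmdist; exact: h.
Qed.

End UniformDistance.

Section IntegralTheory.
Context {R : realType} {X : lspaceType R}.
Variable P : X -> X.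
Hypothesis convP : convexifying P.
Notation mu := (@lebesgue_measure R).
Implicit Types (D : set R) (f g phi : R -> X).

Lemma fine_measure_partition n (T : 'I_n -> set R) (A : set R) :
  measurable A -> (mu A < +oo)%E -> (forall i, measurable (T i)) ->
  trivIset setT T -> A `<=` \bigcup_i T i ->
  fine (mu A) = \sum_(i < n) fine (mu (A `&` T i)).
Proof.
move=> mA A_fin mT tT AT.
have mAT i : measurable (A `&` T i) by exact: measurableI.
have AE : A = \big[setU/set0]_(i < n) (A `&` T i).
  rewrite -bigcup_seq; apply/seteqP; split => [s As|s [i _ []//]].
  by have [i _ Tis] := AT _ As; exists i => //=; rewrite mem_index_enum.
rewrite [in LHS]AE measure_semi_additive_ord/=.
- rewrite sum_fine// => i _; rewrite ge0_fin_numE//.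
  apply: le_lt_trans A_fin; apply: le_measure; rewrite ?inE.
  + exact: mAT.
  + exact: mA.
  + exact: subIsetl.
- exact: mAT.
- by apply: trivIset_setIl.
- by rewrite -AE; exact: mA.
Qed.

(** On the common refinement both sums have the coefficients [m i j]. Refining splits a scalar into
    a sum, which is legitimate because the values of P are convex; a nonempty cell contains a point
    at which the two values can be compared. *)
Lemma simple_integral_dist D g g' v v' (eps : R) :
  measurable D -> (mu D < +oo)%E ->
  simple_integral P D g v -> simple_integral P D g' v' ->
  (forall s, D s -> mdist (g s) (g' s) <= eps) ->
  mdist v v' <= fine (mu D) * eps.
Proof.
move=> mD D_fin [n [T [c [mT tT TD gc ->]]]] [n' [T' [c' [mT' tT' TD' gc'
  ->]]]].
move=> gg'.
pose m i j := fine (mu (T i `&` T' j)).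
have m0 i j : 0 <= m i j by rewrite fine_ge0.
have TS i : T i `<=` D by rewrite -TD; exact: bigcup_sup.
have T'S i : T' i `<=` D by rewrite -TD'; exact: bigcup_sup.
have finS A : measurable A -> A `<=` D -> (mu A < +oo)%E.
  by move=> mA AD; apply: le_lt_trans D_fin; apply: le_measure; rewrite ?inE.
have mTE i : fine (mu (T i)) = \sum_j m i j.
  by apply: fine_measure_partition => //; rewrite ?TD'; auto.
have mT'E j : fine (mu (T' j)) = \sum_i m i j.
  rewrite (fine_measure_partition _ _ mT tT)//; auto; last by rewrite TD.
  by apply: eq_bigr => i _; rewrite setIC.
have -> : \big[sadd/theta]_(i < n) (fine (mu (T i)) **: P (c i)) =
    \big[sadd/theta]_(i < n) \big[sadd/theta]_(j < n') (m i j **: P (c i)).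
  by apply: eq_bigr => i _; rewrite mTE convex_sumr//;
    exact: convexifying_convex.
have -> : \big[sadd/theta]_(j < n') (fine (mu (T' j)) **: P (c' j)) =
    \big[sadd/theta]_(i < n) \big[sadd/theta]_(j < n') (m i j **: P (c' j)).
  rewrite exchange_big/=; apply: eq_bigr => j _.
  by rewrite mT'E convex_sumr//; exact: convexifying_convex.
rewrite (le_trans (mdist_sum _ _ _))//.
have -> : fine (mu D) = \sum_i fine (mu (T i)).
  rewrite (fine_measure_partition mD D_fin mT tT) ?TD//.
  by apply: eq_bigr => i _; rewrite (setIidr (TS i)).
rewrite mulr_suml; apply: ler_sum => i _.
rewrite (le_trans (mdist_sum _ _ _))// mTE mulr_suml.
apply: ler_sum => j _; rewrite mdist_pscale//.
have [e|/set0P[s [Tis T'js]]] := eqVneq (T i `&` T' j) set0.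
  by rewrite /m e measure0 !mul0r.
rewrite ler_wpM2l// (le_trans (convexifying_le convP _ _))//.
by rewrite -(gc i s)// -(gc' j s)//; apply: gg'; exact: TS Tis.
Qed.

Lemma is_integral_dist D f f' v v' (eps : R) :
  measurable D -> (mu D < +oo)%E ->
  is_integral P D f v -> is_integral P D f' v' ->
  (forall s, D s -> mdist (f s) (f' s) <= eps) ->
  mdist v v' <= fine (mu D) * eps.
Proof.
move=> mD D_fin [g [u [gu /uniform_mdistP gf
  /metricType_numDomainType.cvgrPdist_lt uv]]].
move=> [g' [u' [gu' /uniform_mdistP gf' /metricType_numDomainType.cvgrPdist_lt
  uv']]] ff'.
set m := fine (mu D).
have m0 : 0 <= m by rewrite fine_ge0.
apply/ler_addgt0Pl => e e0.
(* Two errors [d] in the simple mappings, weighted by [m], and two in the limits make 2 (m + 1) d =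
   e. *)
pose d := e / (2 * (m + 1)).
have d0 : 0 < d by rewrite divr_gt0// mulr_gt0// ltr_wpDl.
have [n [[gfn gfn'] [uvn uvn']]] : exists n,
    ((forall s, D s -> mdist (f s) (g n s) < d) /\
     (forall s, D s -> mdist (f' s) (g' n s) < d)) /\
    (mdist v (u n) < d /\ mdist v' (u' n) < d).
  apply: (@filter_ex _ \oo).
  by apply: filterI; apply: filterI;
    [exact: gf|exact: gf'|exact: uv|exact: uv'].
have uun : mdist (u n) (u' n) <= m * (eps + d + d).
  apply: (simple_integral_dist mD D_fin (gu n) (gu' n)) => s Ds.
  have := metric_triangle (g n s) (f s) (g' n s).
  have := metric_triangle (f s) (f' s) (g' n s).
  have := ff' _ Ds; have := gfn _ Ds; have := gfn' _ Ds.
  rewrite (mdistC (g n s) (f s)); lra.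
have := metric_triangle v (u n) v'.
have := metric_triangle (u n) (u' n) v'.
rewrite (mdistC (u' n) v').
have -> : e = 2 * (m + 1) * d.
  by rewrite /d mulrC divfK// gt_eqF// mulr_gt0// ltr_wpDl.
nra.
Qed.

Lemma is_integral_uniq D f v v' : measurable D -> (mu D < +oo)%E ->
  is_integral P D f v -> is_integral P D f v' -> v = v'.
Proof.
move=> mD D_fin fv fv'; apply: mdist_positivity; apply/le_anti.
rewrite mdist_ge0 andbT -(mulr0 (fine (mu D))).
by apply: (is_integral_dist mD D_fin fv fv') => s _; rewrite mdistxx.
Qed.

Lemma is_integral_convex D f v : is_integral P D f v -> convex_elements X v.
Proof.
move=> [g [u [gu _ uv]]]; apply: (convex_cvg convP) uv => k.
have [n [T [c [_ _ _ _ ->]]]] := gu k.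
apply: (convex_sum convP) => i; apply: (convexZ convP).
exact: convexifying_convex.
Qed.

Lemma is_integral_cst D (c : X) : measurable D ->
  is_integral P D (fun=> c) (fine (mu D) **: P c).
Proof.
move=> mD; exists (fun _ _ => c), (fun=> fine (mu D) **: P c); split.
- move=> _; exists 1%N, (fun=> D), (fun=> c); split => //.
  + by move=> i j _ _ _; rewrite (ord1 i) (ord1 j).
  + by rewrite bigcup_const//; exists ord0.
  + by rewrite big_ord1.
- apply/uniform_mdistP => e e0; apply: nearW => n s _.
  by rewrite mdistxx.
- exact: cvg_cst.
Qed.

(** Completeness of X enters here: the simple integrals form a Cauchy sequence by
    [simple_integral_dist]. *)
Lemma is_integral_lim D f (g : nat -> R -> X) (u : nat -> X) :
  measurable D -> (mu D < +oo)%E ->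
  (forall k, simple_integral P D (g k) (u k)) -> {uniform D, g @ \oo --> f} ->
  exists v, is_integral P D f v.
Proof.
move=> mD D_fin gu gf.
suff /cvg_ex[v uv] : cvg (u @ \oo) by exists v, g, u.
apply/cauchy_cvgP/cauchy_exP => e e0.
set m := fine (mu D).
have m0 : 0 <= m by rewrite fine_ge0.
pose d := e / (2 * (m + 1)).
have d0 : 0 < d by rewrite divr_gt0// mulr_gt0// ltr_wpDl.
have /uniform_mdistP/(_ _ d0)[N _ gN] := gf.
exists (u N); exists N => //= n Nn; rewrite ballEmdist/=.
apply: (@le_lt_trans _ _ (m * (d + d))); last first.
  have -> : e = 2 * (m + 1) * d.
    by rewrite /d mulrC divfK// gt_eqF// mulr_gt0// ltr_wpDl.
  nra.
apply: (simple_integral_dist mD D_fin (gu N) (gu n)) => s Ds.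
have := metric_triangle (g N s) (f s) (g n s).
have := gN N (leqnn N) _ Ds; have := gN n Nn _ Ds.
rewrite (mdistC (g N s) (f s)); lra.
Qed.

Lemma simple_integral_setU D1 D2 g1 g2 v1 v2 : D1 `&` D2 = set0 ->
  simple_integral P D1 g1 v1 -> simple_integral P D2 g2 v2 ->
  simple_integral P (D1 `|` D2) (fun s => if s \in D1 then g1 s else g2 s)
    (v1 <+> v2).
Proof.
move=> D12 [n [T [c [mT tT TD gc ->]]]] [n' [T' [c' [mT' tT' TD' gc' ->]]]].
have TS i : T i `<=` D1 by rewrite -TD; exact: bigcup_sup.
have T'S i : T' i `<=` D2 by rewrite -TD'; exact: bigcup_sup.
have disj s : D1 s -> D2 s -> False by move=> h1 h2;
  rewrite -[False]/(set0 s) -D12.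
exists (n + n')%N,
  (fun i => match fintype.split i with inl j => T j | inr j => T' j end),
  (fun i => match fintype.split i with inl j => c j | inr j => c' j end).
split.
- by move=> i; case: fintype.split.
- move=> i j _ _ [s []] /=.
  case: (splitP i) (splitP j) => i' ii' [] j' jj' Tis Tjs; apply: val_inj => /=.
  + by rewrite ii' jj' (tT i' j')//; exists s.
  + by case: (disj s); [exact: TS Tis|exact: T'S Tjs].
  + by case: (disj s); [exact: TS Tjs|exact: T'S Tis].
  + by rewrite ii' jj' (tT' i' j')//; exists s.
- rewrite -TD -TD'; apply/seteqP; split=> [s [i _ /=]|s [] [i _ Tis]].
  + by case: fintype.split => j Tjs; [left|right]; exists j.
  + by exists (lshift n' i) => //=; rewrite (unsplitK (inl i)).
  + by exists (rshift n i) => //=; rewrite (unsplitK (inr i)).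
- move=> i s; case: fintype.split => j Tjs.
  + by rewrite mem_set ?(gc j)//; exact: TS Tjs.
  + rewrite memNset ?(gc' j)// => D1s.
    by apply: (disj s) => //; exact: T'S Tjs.
- rewrite big_split_ord/=; congr (_ <+> _); apply: eq_bigr => i _.
  + by rewrite (unsplitK (inl i)).
  + by rewrite (unsplitK (inr i)).
Qed.

Lemma is_integral_setU D1 D2 f v1 v2 : D1 `&` D2 = set0 ->
  is_integral P D1 f v1 -> is_integral P D2 f v2 ->
  is_integral P (D1 `|` D2) f (v1 <+> v2).
Proof.
move=> D12 [g [u [gu /uniform_mdistP gf uv]]] [g' [u' [gu' /uniform_mdistP gf'
  uv']]].
exists (fun k s => if s \in D1 then g k s else g' k s), (fun k => u k <+> u' k).
split.
- by move=> k; exact: simple_integral_setU.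
- apply/uniform_mdistP => e e0.
  have gfe := gf _ e0; have gfe' := gf' _ e0.
  near=> n; move=> s Ds; case: ifPn => [/set_mem|].
    exact: (near gfe n).
  rewrite notin_setE => D1s; apply: (near gfe' n) => //.
  by case: Ds.
- apply/metricType_numDomainType.cvgrPdist_lt => e e0.
  have e20 : 0 < e / 2 by rewrite divr_gt0.
  have uve := metricType_numDomainType.cvgr_dist_lt uv e20.
  have uve' := metricType_numDomainType.cvgr_dist_lt uv' e20.
  near=> n; rewrite (le_lt_trans (mdist_sadd _ _ _ _))// [ltRHS]splitr ltrD//.
    by near: n; exact: uve.
  by near: n; exact: uve'.
Unshelve. all: by end_near. Qed.

End IntegralTheory.

Section IntegralOfContinuous.
Context {R : realType} {X : lspaceType R}.
Variables (P : X -> X) (w : R -> R).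
Hypothesis convP : convexifying P.
Hypothesis modw : modulus_of_continuity w.
Notation mu := (@lebesgue_measure R).
Implicit Types (D : set R) (phi : R -> X).

Lemma measure_itv_fin D (c d : R) : measurable D -> D `<=` `[c, d] ->
  (mu D < +oo)%E.
Proof.
move=> mD Dcd; apply: (@le_lt_trans _ _ (mu `[c, d])).
  by apply: le_measure; rewrite ?inE.
by rewrite lebesgue_measure_itv/=; case: ifPn => // _; rewrite ltry.
Qed.

Lemma exists_integral D phi (c d : R) : measurable D -> c <= d ->
  D `<=` `[c, d] -> Hclass w c d phi -> exists v, is_integral P D phi v.
Proof.
move=> mD cd Dcd phiw.
(* The summand 1 keeps the mesh positive when c = d, and it places d strictly inside the union of
   the half-open cells. *)
pose delta n := (d - c + 1) / n.+1%:R.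
have delta0 n : 0 < delta n by rewrite divr_gt0 ?ltr0n// ltr_wpDl ?subr_ge0.
pose T n (i : 'I_n.+1) := D `&` `[c + i%:R * delta n, c + i.+1%:R * delta n[.
pose node n i := Num.min d (c + i%:R * delta n).
pose cell n s := Num.truncn ((s - c) / delta n).
have inT n (i : 'I_n.+1) s : T n i s <-> D s /\ cell n s = i.
  split=> [[Ds]|[Ds cni]].
    rewrite /= in_itv/= => /andP[cs sc]; split => //; apply: truncn_def.
    by rewrite ler_pdivlMr// ltr_pdivrMr//; apply/andP; split; lra.
  have /andP[cs _] : c <= s <= d by have := Dcd s Ds; rewrite /= in_itv.
  split=> //; rewrite /= in_itv/= -cni.
  have : 0 <= (s - c) / delta n by rewrite divr_ge0 ?subr_ge0// ltW.
  move=> /truncn_itv; rewrite ler_pdivlMr// ltr_pdivrMr// => /andP[h1 h2].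
  by apply/andP; split; lra.
have cellP n s : D s -> (cell n s < n.+1)%N.
  move=> Ds; have /andP[cs sd] : c <= s <= d.
    by have := Dcd s Ds; rewrite /= in_itv.
  have sc0 : 0 <= (s - c) / delta n by rewrite divr_ge0 ?subr_ge0// ltW.
  rewrite truncn_lt_nat// ltr_pdivrMr// /delta mulrC divfK ?pnatr_eq0//; lra.
pose g n s := phi (node n (cell n s)).
pose u n := \big[sadd/theta]_(i < n.+1) (fine (mu (T n i)) **: P (phi (node n
  i))).
refine (is_integral_lim convP mD (measure_itv_fin mD Dcd) (g := g) (u := u) _
  _).
  move=> n; exists n.+1, (T n), (fun i => phi (node n i)); split => //.
  - by move=> i; apply: measurableI => //; exact: measurable_itv.
  - move=> i j _ _ [s [/inT[_ si] /inT[_ sj]]].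
    by apply: val_inj; rewrite /= -si -sj.
  - apply/seteqP; split=> [s [i _ []]//|s Ds].
    by exists (Ordinal (cellP n s Ds)) => //; apply/inT.
  - by move=> i s /inT[Ds si]; rewrite /g si.
apply/uniform_mdistP => e e0.
have /cvgrPdist_lt/(_ _ e0)[/= r r0 wr] := modulus_cvg0 modw.
have rd0 : 0 < r / (d - c + 1) by rewrite divr_gt0// ltr_wpDl ?subr_ge0.
have [N _ Nr] := near_infty_natSinv_lt (PosNum rd0).
exists N => // n /Nr/= nr s Ds.
have delta_r : delta n < r.
  by rewrite /delta mulrC -ltr_pdivlMr// ltr_wpDl ?subr_ge0.
have /andP[cs sd] : c <= s <= d by have := Dcd s Ds; rewrite /= in_itv.
have : 0 <= (s - c) / delta n by rewrite divr_ge0 ?subr_ge0// ltW.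
move=> /truncn_itv; rewrite -/(cell n s) ler_pdivlMr// ltr_pdivrMr// -natr1.
move=> /andP[h1 h2].
have h3 : 0 <= (cell n s)%:R * delta n by rewrite mulr_ge0// ltW.
have nodeE : node n (cell n s) = c + (cell n s)%:R * delta n.
  by rewrite /node min_r//; lra.
apply: (@le_lt_trans _ _ (w (delta n))).
  apply: (@le_trans _ _ (w `|s - node n (cell n s)|)).
    apply: phiw; rewrite ?in_itv/= ?cs// nodeE.
    by apply/andP; split; lra.
  apply: (modulus_homo modw) => //.
  by rewrite nodeE ger0_norm; lra.
have := wr (delta n); rewrite /ball/= !sub0r !normrN (gtr0_norm (delta0 n)).
by move=> /(_ delta_r (delta0 n)); exact/le_lt_trans/ler_norm.
Qed.

Lemma lintegralP D phi (c d : R) : measurable D -> c <= d ->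
  D `<=` `[c, d] -> Hclass w c d phi -> is_integral P D phi (lintegral P D phi).
Proof.
move=> mD cd Dcd phiw; have [v vint] := exists_integral mD cd Dcd phiw.
by rewrite /lintegral; apply: xgetPex; exists v.
Qed.

End IntegralOfContinuous.

(** * Increments of X-valued integrals *)

Section Increments.
Context {R : realType} {X : lspaceType R}.

(* The error term makes comparison of two primitives additive over a fine
   subdivision, where the errors add up to 0. *)
Definition primitive (a b : R) (e : R -> R) (F psi : R -> X) : Prop :=
  forall u v, a <= u -> u <= v -> v <= b ->
  exists j, [/\ convex_elements X j, F v = F u <+> j &
    forall s, u <= s <= v ->
      mdist j ((v - u) **: psi s) <= (v - u) * e (v - u)].

Variables (P : X -> X) (w : R -> R) (a b : R).
Hypothesis convP : convexifying P.
Hypothesis modw : modulus_of_continuity w.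

(** On ]u, v] the mapping [phi] stays within w(v - u) of each of its values there, so its integral
    is close to that of a constant. The integral of a constant applies P to it, hence the density P
    o phi. *)
Lemma lintegral_primitive phi : Hclass w a b phi ->
  primitive a b w (fun t => lintegral P `[a, t] phi) (P \o phi).
Proof.
move=> phiw u v au uv vb.
have ab : a <= b by exact: le_trans au (le_trans uv vb).
have muv : measurable (`]u, v] : set R) by exact: measurable_itv.
have mE : fine (lebesgue_measure (`]u, v] : set R)) = v - u.
  rewrite lebesgue_measure_itv/= lte_fin.
  by move: uv; rewrite le_eqVlt => /predU1P[->|->]//=; rewrite ltxx subrr.
have sub (x y : itv_bound R) : (BLeft a <= x)%O -> (y <= BRight b)%O ->
    [set` Interval x y] `<=` `[a, b].
  by move=> ax yb; apply: subset_itv.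
have intP (D : set R) : measurable D -> D `<=` `[a, b] ->
    is_integral P D phi (lintegral P D phi).
  by move=> mD Dab; apply: (lintegralP convP modw mD ab).
have sub_uv : (`]u, v] : set R) `<=` `[a, b] by apply: sub; rewrite bnd_simp.
have juv := intP _ muv sub_uv.
exists (lintegral P `]u, v] phi); split.
- exact: (is_integral_convex convP) juv.
- have avE : [set` `[a, v]] = [set` `[a, u]] `|` [set` `]u, v]].
    by apply: itv_bndbnd_setU; rewrite bnd_simp.
  have mav : measurable (`[a, v] : set R) by exact: measurable_itv.
  have mau : measurable (`[a, u] : set R) by exact: measurable_itv.
  have sav : (`[a, v] : set R) `<=` `[a, b] by apply: sub; rewrite bnd_simp.
  have sau : (`[a, u] : set R) `<=` `[a, b].
    by apply: sub; rewrite bnd_simp// (le_trans uv).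
  apply: (is_integral_uniq convP mav (measure_itv_fin mav sav) (intP _ mav
    sav)).
  rewrite {1}avE; apply: is_integral_setU => //; last exact: intP.
  apply/seteqP; split => // s [] /=;
    rewrite !in_itv/= => /andP[_ su] /andP[us _].
  by have := lt_le_trans us su; rewrite ltxx.
- move=> s /andP[us sv]; rewrite -mE.
  apply: (is_integral_dist convP muv (measure_itv_fin muv sub_uv) juv).
    exact: is_integral_cst.
  move=> r; rewrite /= in_itv/= => /andP[ur rv].
  apply: (@le_trans _ _ (w `|r - s|)).
    by apply: phiw; rewrite in_itv/=; apply/andP; split; lra.
  rewrite mE; apply: (modulus_homo modw) => //.
  by rewrite ler_norml; apply/andP; split; lra.
Qed.

Lemma lintegral_point phi : a <= b -> Hclass w a b phi ->
  lintegral P `[a, a] phi = theta.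
Proof.
move=> ab phiw; have maa : measurable (`[a, a] : set R) by exact:
  measurable_itv.
have saa : (`[a, a] : set R) `<=` `[a, b].
  by apply: subset_itv; rewrite bnd_simp.
have iaa := lintegralP convP modw maa ab saa phiw.
apply: (is_integral_uniq convP maa (measure_itv_fin maa saa) iaa).
have := @is_integral_cst _ _ P `[a, a] (phi a) maa.
rewrite lebesgue_measure_itv/= ltxx/= sscale0 => -[g [u [gu gf uv]]].
exists g, u; split => //; apply/uniform_mdistP => e e0.
have /uniform_mdistP/(_ _ e0)[N _ gN] := gf.
exists N => // n /gN h s; rewrite /= in_itv/= => /andP[as_ sa].
have -> : s = a by apply/le_anti/andP.
by apply: h; rewrite /= in_itv/= lexx.
Qed.

End Increments.

(** * Hukuhara primitives *)

Section PrimitiveTheory.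
Context {R : realType} {X : lspaceType R}.
Implicit Types (e J : R -> R) (F psi A B : R -> X).

(** Over a short step A and B grow by about (v - u) psi(u) and (v - u) psi'(u), so the distance
    minus J has small increments. J plays the role of a primitive of the pointwise distance of the
    densities. *)
Lemma primitive_dist (c d : R) e e' e'' A B psi psi' J :
  e x @[x --> 0^'+] --> 0 -> e' x @[x --> 0^'+] --> 0 ->
  e'' x @[x --> 0^'+] --> 0 ->
  primitive c d e A psi -> primitive c d e' B psi' ->
  (forall u v, c <= u -> u < v -> v <= d ->
    (v - u) * mdist (psi u) (psi' u) <= J v - J u + (v - u) * e'' (v - u)) ->
  c <= d -> mdist (A d) (B d) <= mdist (A c) (B c) + (J d - J c).
Proof.
move=> e0 e'0 e''0 primA primB HJ cd.
have E0 : (e x + e' x + e'' x) @[x --> 0^'+] --> 0.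
  by have := cvgD (cvgD e0 e'0) e''0; rewrite !addr0; exact.
suff : mdist (A d) (B d) - J d <= mdist (A c) (B c) - J c by lra.
apply: (small_increments (D := fun u => mdist (A u) (B u) - J u) E0) =>
  // u v cu uv vd.
have [ja [_ -> Ja]] := primA _ _ cu (ltW uv) vd.
have [jb [_ -> Jb]] := primB _ _ cu (ltW uv) vd.
have uuv : u <= u <= v by rewrite lexx ltW.
have vu0 : 0 <= v - u by rewrite subr_ge0 ltW.
have := HJ _ _ cu uv vd.
have := Ja _ uuv; have := Jb _ uuv.
have := mdist_sadd (A u) (B u) ja jb.
have := metric_triangle ja ((v - u) **: psi u) jb.
have := metric_triangle ((v - u) **: psi u) ((v - u) **: psi' u) jb.
rewrite (mdist_pscale _ _ vu0) (mdistC jb); lra.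
Qed.

(** The comparison partner when a mean is measured against a single value. Convexity of [x] is what
    gives v x = u x + (v - u) x. *)
Lemma primitive_scale (c d : R) (x : X) : convex_elements X x -> 0 <= c ->
  primitive c d (fun=> 0) (fun u => u **: x) (fun=> x).
Proof.
move=> cx c0 u v cu uv _.
have uv0 : 0 <= v - u by rewrite subr_ge0.
exists ((v - u) **: x); split.
- by move=> k l k0 l0; rewrite !sscaleA mulrDl cx// mulr_ge0.
- by rewrite -(cx u (v - u)) ?subrKC// (le_trans c0).
- by move=> s _; rewrite mdistxx mulr0.
Qed.

(** Unoriented, because the difference is only available from the right end to the left end, while
    rays must be able to run to the left. *)
Definition hinc F (x y : R) : X := hdiff (F (Num.max x y)) (F (Num.min x y)).

Variables (P : X -> X) (a b : R) (e : R -> R) (f psi : R -> X).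
Hypothesis isoX : isotropic X.
Hypothesis convP : convexifying P.
Hypothesis fpsi : primitive a b e f psi.

Lemma hincC x y : hinc f x y = hinc f y x.
Proof. by rewrite /hinc maxC minC. Qed.

Lemma hincE x y : x <= y -> hinc f x y = hdiff (f y) (f x).
Proof. by move=> xy; rewrite /hinc max_r// min_l. Qed.

Lemma hdiff_primitive u v : a <= u -> u <= v -> v <= b ->
  [/\ convex_elements X (hdiff (f v) (f u)),
      f v = f u <+> hdiff (f v) (f u) &
      forall s, u <= s <= v -> mdist (hdiff (f v) (f u)) ((v - u) **: psi s) <=
        (v - u) * e (v - u)].
Proof.
move=> au uv vb; have [j [cj fvu je]] := fpsi au uv vb.
by rewrite (hdiffE isoX fvu); split.
Qed.

Lemma hdiff_chain u s v : a <= u -> u <= s -> s <= v -> v <= b ->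
  hdiff (f v) (f u) = hdiff (f s) (f u) <+> hdiff (f v) (f s).
Proof.
move=> au us sv vb; apply: (hdiffE isoX).
have [_ fv _] := hdiff_primitive (le_trans au us) sv vb.
have [_ fs _] := hdiff_primitive au us (le_trans sv vb).
by rewrite {1}fv {1}fs saddA.
Qed.

Lemma hincxx x : hinc f x x = theta.
Proof. by rewrite hincE//; apply: (hdiffE isoX); rewrite saddx0. Qed.

Lemma hinc_chain x s y : a <= x <= b -> a <= y <= b ->
  Num.min x y <= s <= Num.max x y ->
  hinc f x y = hinc f x s <+> hinc f s y.
Proof.
wlog xy : x y / x <= y => [H hx hy hs|/andP[ax _] /andP[_ yb]].
  have [xy|/ltW yx] := leP x y; first exact: H.
  have := H y x yx hy hx; rewrite minC maxC => /(_ hs).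
  by rewrite hincC saddC (hincC x s) (hincC s y).
rewrite min_l// max_r// => /andP[xs sy].
by rewrite !hincE// ?(le_trans xs)//; exact: hdiff_chain.
Qed.

Lemma hinc_primitive x y s : a <= x <= b -> a <= y <= b ->
  Num.min x y <= s <= Num.max x y ->
  mdist (hinc f x y) (`|x - y| **: psi s) <= `|x - y| * e `|x - y|.
Proof.
wlog xy : x y / x <= y => [H hx hy hs|/andP[ax _] /andP[_ yb]].
  have [xy|/ltW yx] := leP x y; first exact: H.
  by rewrite distrC hincC; apply: H => //; rewrite minC maxC.
rewrite min_l// max_r// => xsy.
rewrite hincE// distrC ger0_norm ?subr_ge0//.
by have [_ _] := hdiff_primitive ax xy yb; apply.
Qed.

Lemma hinc_convex x y : a <= x <= b -> a <= y <= b ->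
  convex_elements X (hinc f x y).
Proof.
move=> /andP[ax xb] /andP[ay yb].
have [] // := @hdiff_primitive (Num.min x y) (Num.max x y).
- by rewrite le_min ax.
- by rewrite ge_min le_max lexx.
- by rewrite ge_max xb.
Qed.

(** The substitution s = q + c u in the language of primitives: an increment over a length |c| (v -
    u), divided by |c|, has density psi(q + c u). *)
Lemma primitive_ray (c q al : R) : c != 0 -> 0 <= al ->
  a <= q <= b -> a <= q + c * al <= b ->
  primitive 0 al (fun x => e (`|c| * x))
    (fun u => `|c|^-1 **: hinc f q (q + c * u)) (fun u => psi (q + c * u)).
Proof.
move=> c0 al0 /andP[aq qb] /andP[aqal qalb] u v u0 uv val.
have nc0 : 0 < `|c| by rewrite normr_gt0.
have inab s : 0 <= s <= al -> a <= q + c * s <= b.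
  move=> /andP[s0 sal]; have [c_ge0|c_lt0] := leP 0 c; apply/andP; split; nra.
have uab : a <= q + c * u <= b by apply: inab; rewrite u0 (le_trans uv).
have vab : a <= q + c * v <= b by apply: inab; rewrite (le_trans u0).
have mid x y z : x <= y <= z ->
    Num.min (q + c * x) (q + c * z) <= q + c * y <= Num.max (q + c * x) (q + c
      * z).
  move=> /andP[xy yz]; rewrite ge_min le_max !lerD2l.
  have [c_ge0|/ltW c_le0] := leP 0 c.
    by rewrite (ler_wpM2l c_ge0 xy) (ler_wpM2l c_ge0 yz) orbT.
  by rewrite (ler_wnM2l c_le0 xy) (ler_wnM2l c_le0 yz) orbT.
have dE : `|q + c * u - (q + c * v)| = `|c| * (v - u).
  rewrite opprD addrACA subrr add0r -mulrBr normrM distrC.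
  by rewrite (ger0_norm (_ : 0 <= v - u)) ?subr_ge0.
exists (`|c|^-1 **: hinc f (q + c * u) (q + c * v)); split.
- by apply: (convexZ convP); exact: hinc_convex.
- rewrite -sscaleDr -hinc_chain//; first by rewrite aq.
  by have := mid 0 u v; rewrite mulr0 addr0 u0 uv; apply.
- move=> s usv; have := hinc_primitive uab vab (mid _ _ _ usv).
  rewrite dE => ineq.
  have -> : (v - u) **: psi (q + c * s) =
      `|c|^-1 **: ((`|c| * (v - u)) **: psi (q + c * s)).
    by rewrite sscaleA mulKf// gt_eqF.
  rewrite mdist_pscale ?invr_ge0//.
  by rewrite -(ler_pM2l nc0) mulrA divff ?gt_eqF// mul1r mulrA.
Qed.

End PrimitiveTheory.

(** * Derivatives and comparison of means *)

Section PrimitiveInequalities.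
Context {R : realType} {X : lspaceType R}.
Variables (P : X -> X) (a b : R) (e w : R -> R) (f psi : R -> X) (M : R).
Hypothesis isoX : isotropic X.
Hypothesis convP : convexifying P.
Hypothesis modw : modulus_of_continuity w.
Hypothesis e_cvg0 : e x @[x --> 0^'+] --> 0.
Hypothesis fpsi : primitive a b e f psi.

Lemma primitive_quotient u v s : a <= u -> u < v -> v <= b -> u <= s <= v ->
  mdist (psi s) ((v - u)^-1 **: hdiff (f v) (f u)) <= e (v - u).
Proof.
move=> au uv vb usv; have vu0 : 0 < v - u by rewrite subr_gt0.
have [_ _ /(_ _ usv) ineq] := hdiff_primitive isoX fpsi au (ltW uv) vb.
rewrite -[X in mdist X _]sscale1 -(mulVf (lt0r_neq0 vu0)) -sscaleA.
by rewrite mdist_pscale ?invr_ge0 ?(ltW vu0)// mdistC ler_pdivrMl.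
Qed.

Lemma primitive_hderiv t : t \in `[a, b] -> is_hderiv a b f t (psi t).
Proof.
rewrite in_itv/= => /andP[at_ tb].
have e_lt eps : 0 < eps -> \forall c \near 0^'+, e c < eps.
  move=> eps0; have /cvgrPdist_lt/(_ _ eps0) ee := e_cvg0.
  near=> c; have : `|0 - e c| < eps by near: c.
  by rewrite sub0r normrN; exact/le_lt_trans/ler_norm.
split=> [lt_tb|lt_at].
  have tcb : \forall c \near 0^'+, 0 < c /\ t + c <= b.
    near=> c; split; first by near: c; exact: nbhs_right_gt.
    by rewrite -lerBrDl; near: c; apply: nbhs_right_le; rewrite subr_gt0.
  split.
    near=> c; have [c0 tc] : 0 < c /\ t + c <= b by near: c.
    have ttc : t <= t + c by rewrite lerDl ltW.
    have [_ ftc _] := hdiff_primitive isoX fpsi at_ ttc tc.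
    by exists (hdiff (f (t + c)) (f t)).
  apply/metricType_numDomainType.cvgrPdist_lt => eps /e_lt ee.
  near=> c; have [c0 tc] : 0 < c /\ t + c <= b by near: c.
  have ttc : t < t + c by rewrite ltrDl.
  have := primitive_quotient at_ ttc tc (s := t).
  rewrite lexx (ltW ttc) addrAC subrr add0r => /(_ isT)/le_lt_trans; apply.
  by near: c.
have atc : \forall c \near 0^'+, 0 < c /\ a <= t - c.
  near=> c; split; first by near: c; exact: nbhs_right_gt.
  rewrite lerBrDr addrC -lerBrDr.
  by near: c; apply: nbhs_right_le; rewrite subr_gt0.
split.
  near=> c; have [c0 tc] : 0 < c /\ a <= t - c by near: c.
  have tct : t - c <= t by rewrite gerBl ltW.
  have [_ ftc _] := hdiff_primitive isoX fpsi tc tct tb.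
  by exists (hdiff (f t) (f (t - c))).
apply/metricType_numDomainType.cvgrPdist_lt => eps /e_lt ee.
near=> c; have [c0 tc] : 0 < c /\ a <= t - c by near: c.
have tct : t - c < t by rewrite gtrBl.
have := primitive_quotient tc tct tb (s := t).
rewrite lexx (ltW tct) subKr => /(_ isT)/le_lt_trans; apply.
by near: c.
Unshelve. all: by end_near. Qed.

Lemma primitive_hderivable : hderivable a b f.
Proof. by move=> t tab; exists (psi t); exact: primitive_hderiv. Qed.

(** Since a < b, at least one of the two one-sided conditions at [t] is not vacuous, and the
    uniqueness of its limit determines the derivative. *)
Lemma hderivE t : a < b -> t \in `[a, b] -> hderiv a b f t = psi t.
Proof.
move=> ab tab; rewrite /hderiv; have prim := primitive_hderiv tab.
case: xgetP => [l _ [r lf]|/(_ (psi t))/=/(_ prim)//].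
have [r' lf'] := prim.
move: tab; rewrite in_itv/= => /andP[at_ tb].
have [lt_tb|le_bt] := ltP t b.
  have [_ rl] := r lt_tb; have [_ rl'] := r' lt_tb.
  exact: (cvg_unique (@metric_hausdorff R X) rl rl').
have lt_at : a < t by exact: lt_le_trans ab le_bt.
have [_ rl] := lf lt_at; have [_ rl'] := lf' lt_at.
exact: (cvg_unique (@metric_hausdorff R X) rl rl').
Qed.

Hypothesis M0 : 0 <= M.
Hypothesis psiM : forall s t, s \in `[a, b] -> t \in `[a, b] ->
  mdist (psi s) (psi t) <= M * w `|s - t|.

(** At parameter u the two rays are k u apart, so their densities differ by at most M w(k u), which
    is the derivative of (M / k) I(k u). *)
Lemma ray_dist (c c' q al : R) : c != 0 -> c' != 0 -> c != c' -> 0 <= al ->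
  a <= q <= b -> a <= q + c * al <= b -> a <= q + c' * al <= b ->
  mdist (`|c|^-1 **: hinc f q (q + c * al)) (`|c'|^-1 **: hinc f q (q + c' *
    al))
    <= M / `|c - c'| * Iw w (`|c - c'| * al).
Proof.
move=> c0 c'0 cc' al0 qab cab c'ab; set k := `|c - c'|.
have k0 : 0 < k by rewrite normr_gt0 subr_eq0.
have Ec (d : R) : d != 0 -> e (`|d| * x) @[x --> 0^'+] --> 0.
  by rewrite -normr_gt0 => d0; exact: (cvg_right0_scale d0 e_cvg0).
have := primitive_dist (Ec _ c0) (Ec _ c'0) (cvg_cst (0 : R))
  (primitive_ray isoX convP fpsi c0 al0 qab cab)
  (primitive_ray isoX convP fpsi c'0 al0 qab c'ab)
  (J := fun u => M / k * Iw w (k * u)).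
rewrite /= !mulr0 !addr0 (hincxx f isoX) !sscale_theta mdistxx add0r Iw0 mulr0
  subr0.
apply=> // u v u0 uv val; rewrite mulr0 addr0.
have inab d : a <= q + d * al <= b -> q + d * u \in `[a, b].
  move: qab => /andP[aq qb] /andP[ad db]; rewrite in_itv/=.
  by apply/andP; split; nra.
have := psiM (inab c cab) (inab c' c'ab).
have -> : `|q + c * u - (q + c' * u)| = k * u.
  by rewrite opprD addrACA subrr add0r -mulrBl normrM (ger0_norm u0).
have ku0 : 0 <= k * u by rewrite mulr_ge0// ltW.
have kuv : k * u <= k * v by rewrite ler_pM2l// ltW.
have /andP[+ _] := Iw_increment modw ku0 kuv.
rewrite -mulrBr -mulrBr => h1 h2.
apply: (@le_trans _ _ ((v - u) * (M * w (k * u)))).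
  by rewrite ler_pM2l// subr_gt0.
have -> : (v - u) * (M * w (k * u)) = M / k * (k * (v - u) * w (k * u)).
  by field; rewrite gt_eqF.
by rewrite ler_wpM2l// divr_ge0// ltW.
Qed.

(** The analogue of [ray_dist] in which the second ray stands still at [q]: its velocity is 0, and
    the multiple [u **: psi q] replaces the increment divided by the speed. *)
Lemma ray_value_dist (c q al : R) : c != 0 -> 0 <= al ->
  convex_elements X (psi q) -> a <= q <= b -> a <= q + c * al <= b ->
  mdist (`|c|^-1 **: hinc f q (q + c * al)) (al **: psi q)
    <= M / `|c| * Iw w (`|c| * al).
Proof.
move=> c0 al0 cpsi qab cab.
have k0 : 0 < `|c| by rewrite normr_gt0.
have := primitive_dist (cvg_right0_scale k0 e_cvg0) (cvg_cst (0 : R))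
  (cvg_cst (0 : R)) (primitive_ray isoX convP fpsi c0 al0 qab cab)
  (primitive_scale (d := al) cpsi (lexx 0)) (J := fun u =>
    M / `|c| * Iw w (`|c| * u)).
rewrite /= !mulr0 !addr0 (hincxx f isoX) sscale_theta sscale0 mdistxx add0r Iw0.
rewrite mulr0 subr0.
apply=> // u v u0 uv val; rewrite mulr0 addr0.
have inab : q + c * u \in `[a, b].
  move: qab cab => /andP[aq qb] /andP[ad db]; rewrite in_itv/=.
  by apply/andP; split; nra.
have qab' : q \in `[a, b] by rewrite in_itv.
have := psiM inab qab'.
have -> : `|q + c * u - q| = `|c| * u.
  by rewrite addrAC subrr add0r normrM (ger0_norm u0).
have ku0 : 0 <= `|c| * u by rewrite mulr_ge0// ltW.
have kuv : `|c| * u <= `|c| * v by rewrite ler_pM2l// ltW.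
have /andP[+ _] := Iw_increment modw ku0 kuv.
rewrite -mulrBr -mulrBr => h1 h2.
apply: (@le_trans _ _ ((v - u) * (M * w (`|c| * u)))).
  by rewrite ler_pM2l// subr_gt0.
have -> : (v - u) * (M * w (`|c| * u)) =
    M / `|c| * (`|c| * (v - u) * w (`|c| * u)).
  by field; rewrite gt_eqF.
by rewrite ler_wpM2l// divr_ge0// ltW.
Qed.

(* Only the excess of the mean over the small interval is transported: the mass
   on [t - h1, t - g1] is reflected about t - g1 onto [t - g1, p], and that on
   [t + g2, t + h2] about t + g2 onto [p, t + g2]. *)
Lemma average_dist (t g1 g2 h1 h2 : R) : 0 <= g1 -> 0 <= g2 -> g1 <= h1 ->
  g2 <= h2 -> 0 < g1 + g2 -> a <= t - h1 -> t + h2 <= b ->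
  mdist ((g1 + g2)^-1 **: hdiff (f (t + g2)) (f (t - g1)))
        ((h1 + h2)^-1 **: hdiff (f (t + h2)) (f (t - h1))) <=
  M * Kw w g1 g2 h1 h2.
Proof.
move=> g1_ge0 g2_ge0 gh1 gh2 G0 ath1 th2b.
set G := g1 + g2 in G0 *; set H := h1 + h2.
set al := h1 - g1; set be := h2 - g2; set r := al + be.
have al0 : 0 <= al by rewrite subr_ge0.
have be0 : 0 <= be by rewrite subr_ge0.
have HE : H = G + r by rewrite /H /G /r /al /be; ring.
have [r_le0|r0] := leP r 0.
  have [gh1' gh2'] : g1 = h1 /\ g2 = h2 by rewrite /r /al /be in r_le0; split;
    lra.
  have KE : Kw w g1 g2 h1 h2 = 0.
    by rewrite /Kw gh1' gh2' !subrr addr0 !mul0r.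
  by rewrite KE mulr0 /G /H gh1' gh2' mdistxx.
have H0 : 0 < H by rewrite HE addr_gt0.
(* With this ratio the images of the two excess pieces have lengths c al and c be and fill the small
   interval exactly, meeting at [p]. *)
pose c := G / r; have c0 : 0 < c by rewrite divr_gt0.
have cr : c * al + c * be = G by rewrite -mulrDr /c divfK// gt_eqF.
pose p := t - g1 + c * al.
have cal0 : 0 <= c * al by rewrite mulr_ge0// ltW.
have cbe0 : 0 <= c * be by rewrite mulr_ge0// ltW.
have pE : p = t + g2 - c * be by rewrite /p; move: cr; rewrite /G; lra.
have ord : [/\ t - h1 <= t - g1, t - g1 <= p, p <= t + g2 & t + g2 <= t + h2].
  by split; [lra|rewrite /p lerDl|rewrite pE gerBl|lra].
have [ord1 ord2 ord3 ord4] := ord.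
set S1 := hdiff (f p) (f (t - g1)); set S2 := hdiff (f (t + g2)) (f p).
set B1 := hdiff (f (t - g1)) (f (t - h1)).
set B2 := hdiff (f (t + h2)) (f (t + g2)).
set S := hdiff (f (t + g2)) _; set B := hdiff (f (t + h2)) (f (t - h1)).
have k1 : `|c - -1| = H / r.
  have c1 : 0 < c + 1 by lra.
  by rewrite opprK (gtr0_norm c1) HE mulrDl divff ?gt_eqF.
have k2 : `|- c - 1| = H / r by rewrite -k1 -normrN opprB !opprK addrC.
have cn0 : c != 0 by rewrite gt_eqF.
have n10 : -1 != 0 :> R by rewrite oppr_eq0 oner_eq0.
have L1 : mdist (c^-1 **: S1) B1 <= M / (H / r) * Iw w (H * al / r).
  have alE : t - g1 + -1 * al = t - h1 by rewrite /al; ring.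
  have := @ray_dist c (-1) (t - g1) al cn0 n10.
  rewrite k1 normrN1 invr1 sscale1 (gtr0_norm c0) alE -/p hincE//.
  rewrite (hincC _ (t - g1)) hincE// [H / r * al]mulrAC.
  by apply => //; try (apply/andP; split); lra.
have L2 : mdist (c^-1 **: S2) B2 <= M / (H / r) * Iw w (H * be / r).
  have beE : t + g2 + 1 * be = t + h2 by rewrite /be; ring.
  have cN0 : - c != 0 by rewrite oppr_eq0.
  have := @ray_dist (- c) 1 (t + g2) be cN0 (oner_neq0 R).
  rewrite k2 normrN normr1 invr1 sscale1 (gtr0_norm c0) beE mulNr -pE.
  rewrite (hincC _ (t + g2) p) hincE// hincE// [H / r * be]mulrAC.
  by apply => //; try (apply/andP; split); lra.
have SE : S = S1 <+> S2.
  by apply: (hdiff_chain isoX fpsi) => //; lra.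
have BE : B = B1 <+> S <+> B2.
  rewrite /B (hdiff_chain isoX fpsi (s := t - g1)) -?saddA//; last lra.
  by congr (_ <+> _); apply: (hdiff_chain isoX fpsi); lra.
have cS : convex_elements X S.
  by have [] // := @hdiff_primitive _ _ _ _ _ _ _ isoX fpsi (t - g1) (t + g2);
    lra.
(* One full copy of S is split off, by convexity, to be cancelled against the S inside B; the
   remaining S / c is matched with B1 and B2. *)
have HS : (H / G) **: S = (c^-1 **: S1 <+> S <+> c^-1 **: S2).
  have -> : H / G = 1 + c^-1 by rewrite /c invf_div HE mulrDl divff ?gt_eqF.
  have ci0 : 0 <= c^-1 by rewrite invr_ge0 ltW.
  rewrite (cS _ _ ler01 ci0) sscale1 [in X in _ <+> X]SE sscaleDr.
  by rewrite saddA (saddC S).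
have HSB : mdist ((H / G) **: S) B <=
    M / (H / r) * (Iw w (H * al / r) + Iw w (H * be / r)).
  rewrite HS BE mulrDr (le_trans (mdist_sadd _ _ _ _))// lerD//.
  by rewrite isoX.
have -> : G^-1 **: S = H^-1 **: ((H / G) **: S).
  by rewrite sscaleA mulKf// gt_eqF.
have Hi0 : 0 <= H^-1 by rewrite invr_ge0 ltW.
rewrite (mdist_pscale _ _ Hi0) ler_pdivrMl//.
rewrite (le_trans HSB)// /Kw -/al -/be -/r -/H le_eqVlt; apply/orP; left.
by apply/eqP; field; rewrite !gt_eqF.
Qed.

(** Both halves are compared with the constant [psi t] along rays of unit speed, and convexity joins
    h1 psi(t) and h2 psi(t) into (h1 + h2) psi(t). *)
Lemma value_average_dist (t h1 h2 : R) : convex_elements X (psi t) ->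
  0 <= h1 -> 0 <= h2 -> 0 < h1 + h2 -> a <= t - h1 -> t + h2 <= b ->
  mdist (psi t) ((h1 + h2)^-1 **: hdiff (f (t + h2)) (f (t - h1))) <=
  M * ((Iw w h1 + Iw w h2) / (h1 + h2)).
Proof.
move=> cpsi h1_ge0 h2_ge0 H0 ath1 th2b.
have L1 : mdist (hdiff (f t) (f (t - h1))) (h1 **: psi t) <= M * Iw w h1.
  have := @ray_value_dist (-1) t h1; rewrite oppr_eq0 oner_eq0 normrN1 invr1.
  rewrite sscale1 mulr1 mul1r mulN1r hincC hincE; last by rewrite gerBl.
  by apply => //; apply/andP; split; lra.
have L2 : mdist (hdiff (f (t + h2)) (f t)) (h2 **: psi t) <= M * Iw w h2.
  have := @ray_value_dist 1 t h2; rewrite oner_eq0 normr1 invr1.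
  rewrite sscale1 mulr1 !mul1r hincE; last by rewrite lerDl.
  by apply => //; apply/andP; split; lra.
have -> : psi t = (h1 + h2)^-1 **: ((h1 + h2) **: psi t).
  by rewrite sscaleA mulVf ?sscale1// gt_eqF.
have Hi0 : 0 <= (h1 + h2)^-1 by rewrite invr_ge0 ltW.
rewrite (mdist_pscale _ _ Hi0) mulrA ler_pdivlMr// mulrC.
rewrite mulrA divff ?gt_eqF// mul1r cpsi// mdistC mulrDr.
rewrite (hdiff_chain isoX fpsi (s := t)); try lra.
by rewrite (le_trans (mdist_sadd _ _ _ _))// lerD.
Qed.

(** By isotropy the norm of a Hukuhara difference is the distance of its two terms, which is at most
    2 C by way of theta. *)
Lemma lnorm_average (u v C : R) : a <= u -> u < v -> v <= b ->
  lnorm (f u) <= C -> lnorm (f v) <= C ->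
  lnorm ((v - u)^-1 **: hdiff (f v) (f u)) <= 2 / (v - u) * C.
Proof.
move=> au uv vb fu fv; have uv0 : 0 < v - u by rewrite subr_gt0.
have uvi0 : 0 <= (v - u)^-1 by rewrite invr_ge0 ltW.
rewrite (lnorm_scale _ uvi0) mulrAC mulrC ler_pM2r ?invr_gt0//.
have [_ fvu _] := hdiff_primitive isoX fpsi au (ltW uv) vb.
rewrite -(mdist_hdiff isoX fvu) (le_trans (metric_triangle _ theta _))//.
by rewrite (mdistC theta) mulr2n mulrDl mul1r lerD.
Qed.

End PrimitiveInequalities.

(** * The two norms as genuine suprema *)

Section Norms.
Context {R : realType} {X : lspaceType R}.
Variables (w : R -> R) (a b : R).
Hypothesis modw : modulus_of_continuity w.
Hypothesis w_neq0 : exists2 s, 0 <= s & w s != 0.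
Hypothesis ab : a < b.

(** The bound [k] and a < b make the set of quotients bounded and nonempty, so that [sup] is the
    least admissible constant and not a default value. *)
Lemma omega_normP (g : R -> X) (k : R) :
  (forall s t, s \in `[a, b] -> t \in `[a, b] ->
    mdist (g s) (g t) <= k * w `|s - t|) ->
  [/\ 0 <= omega_norm w a b g, omega_norm w a b g <= k &
    forall s t, s \in `[a, b] -> t \in `[a, b] ->
      mdist (g s) (g t) <= omega_norm w a b g * w `|s - t|].
Proof.
move=> gk; rewrite /omega_norm; set Q := [set r | _].
have w_gt0 (s t : R) : s != t -> 0 < w `|s - t|.
  by move=> st; apply: modulus_gt0 => //; rewrite normr_gt0 subr_eq0.
have Qk : ubound Q k.
  by move=> _ [s [t [sab tab st ->]]]; rewrite ler_pdivrMr ?w_gt0// gk.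
have ab_in : a \in `[a, b] /\ b \in `[a, b].
  by rewrite !in_itv/= !lexx ltW.
have Qab : Q (mdist (g a) (g b) / w `|a - b|).
  by exists a, b; split => //; [exact: ab_in.1|exact: ab_in.2|rewrite lt_eqF].
have Qsup r : Q r -> r <= sup Q by apply: ub_le_sup; exists k.
split.
- apply: le_trans (Qsup _ Qab); rewrite divr_ge0 ?mdist_ge0//.
  exact: (modulus_ge0 modw).
- by apply: ge_sup => //; exists (mdist (g a) (g b) / w `|a - b|).
- move=> s t sab tab; have [->|st] := eqVneq s t.
    by rewrite mdistxx subrr normr0 (modulus0 modw) mulr0.
  by rewrite -ler_pdivrMr ?w_gt0//; apply: Qsup; exists s, t.
Qed.

Lemma C_norm_le (f : R -> X) (C : R) :
  (forall t, t \in `[a, b] -> lnorm (f t) <= C) -> C_norm a b f <= C.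
Proof.
move=> fC; apply: ge_sup => [|_ [t tab <-]]; last exact: fC.
by exists (lnorm (f a)); exists a => //=; rewrite in_itv/= lexx ltW.
Qed.

Lemma le_C_norm (f : R -> X) (C t : R) :
  (forall t, t \in `[a, b] -> lnorm (f t) <= C) -> t \in `[a, b] ->
  lnorm (f t) <= C_norm a b f.
Proof.
move=> fC tab; apply: ub_le_sup; last by exists t.
by exists C => _ [s sab <-]; exact: fC.
Qed.

(** Makes the supremum in [C_norm] finite on the class. *)
Lemma primitive_bounded (k : R) (f psi : R -> X) : 0 <= k ->
  primitive a b (fun x => k * w x) f psi ->
  forall t, t \in `[a, b] -> lnorm (f t) <=
    lnorm (f a) + (b - a) * (k * w (b - a) + lnorm (psi a)).
Proof.
move=> k0 fpsi t; rewrite in_itv/= => /andP[at_ tb].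
have [j [_ -> jpsi]] := fpsi a t (lexx a) at_ tb.
rewrite (le_trans (lnorm_sadd _ _))// lerD2l.
have ta0 : 0 <= t - a by rewrite subr_ge0.
have := jpsi a; rewrite lexx at_ => /(_ isT) ja.
rewrite (le_trans (lnorm_le j ((t - a) **: psi a)))// lnorm_scale//.
apply: (@le_trans _ _ ((t - a) * (k * w (t - a) + lnorm (psi a)))).
  by rewrite mulrDr lerD2r.
have w0 : 0 <= k * w (t - a) by rewrite mulr_ge0// modulus_ge0.
have wle : k * w (t - a) <= k * w (b - a).
  by rewrite ler_wpM2l// (modulus_homo modw)// lerB.
have := lnorm_ge0 (psi a) => n0.
by apply: ler_pM; lra.
Qed.

End Norms.

(** * The inequalities on the class *)

Section Cone.
Context {R : realType} {X : lspaceType R}.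
Variables (P : X -> X) (w : R -> R) (a b : R).
Hypothesis convP : convexifying P.
Hypothesis modw : modulus_of_continuity w.

(** Extracts what the inequalities use of the class: a convex-valued density, whose modulus k w is
    inherited from [phi] because P does not increase distances. *)
Lemma W1Hcone_primitive (f : R -> X) : W1Hcone P w a b f ->
  exists (k : R) psi, [/\ 0 < k, forall s, convex_elements X (psi s),
    primitive a b (fun x => k * w x) f psi &
    forall s t, s \in `[a, b] -> t \in `[a, b] ->
      mdist (psi s) (psi t) <= k * w `|s - t|].
Proof.
move=> [k [g [k0 [x [phi [cx phiw gE]]] fE]]].
exists k, (fun s => k **: P (phi s)); split => //.
- by move=> s; apply: (convexZ convP); exact: convexifying_convex.
- move=> u v au uv vb.
  have [j [cj Lv jphi]] := lintegral_primitive convP modw phiw au uv vb.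
  have uab : u \in `[a, b] by rewrite in_itv/= au (le_trans uv).
  have vab : v \in `[a, b] by rewrite in_itv/= vb (le_trans au).
  exists (k **: j); split; first exact: (convexZ convP).
    by rewrite !fE// !gE// Lv !sscaleDr saddA.
  move=> s usv; have -> : (v - u) **: (k **: P (phi s)) =
      k **: ((v - u) **: P (phi s)) by rewrite !sscaleA mulrC.
  by rewrite (mdist_pscale _ _ (ltW k0)) mulrCA ler_pM2l// jphi.
- move=> s t sab tab; rewrite (mdist_pscale _ _ (ltW k0)) ler_pM2l//.
  by rewrite (le_trans (convexifying_le convP _ _))// phiw.
Qed.

Hypothesis isoX : isotropic X.
Hypothesis w_neq0 : exists2 s, 0 <= s & w s != 0.
Hypothesis ab : a < b.

Lemma cone_inequalities (t g1 g2 h1 h2 : R) (f : R -> X) :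
  t \in `[a, b] -> 0 <= g1 -> 0 <= g2 -> g1 <= h1 -> g2 <= h2 ->
  0 < g1 + g2 -> a <= t - h1 -> t + h2 <= b -> W1Hcone P w a b f ->
  [/\ hdiff_exists (f (t + g2)) (f (t - g1)), hderivable a b f,
      lnorm (divided_diff g1 g2 f t) <=
        Kw w g1 g2 h1 h2 * omega_norm w a b (hderiv a b f) +
        2 / (h1 + h2) * C_norm a b f
    & lnorm (hderiv a b f t) <=
        (Iw w h1 + Iw w h2) / (h1 + h2) * omega_norm w a b (hderiv a b f) +
        2 / (h1 + h2) * C_norm a b f].
Proof.
move=> tab g1_ge0 g2_ge0 gh1 gh2 G0 ath1 th2b.
move=> /W1Hcone_primitive[k [psi [k0 cpsi fpsi psik]]].
have e0 : k * w x @[x --> 0^'+] --> 0.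
  by have := modulus_scale_cvg0 modw k ler01; under eq_fun do rewrite mul1r.
have hdE := hderivE isoX e0 fpsi ab.
have [|M0 _ HM] := @omega_normP _ _ w a b modw w_neq0 ab (hderiv a b f) k.
  by move=> s r sab rab; rewrite !hdE// psik.
(* The constant [k] has served to make the norm finite; from here the modulus of the density is
   measured by the norm itself. *)
set M := omega_norm _ _ _ _ in M0 HM *.
have psiM s r : s \in `[a, b] -> r \in `[a, b] ->
    mdist (psi s) (psi r) <= M * w `|s - r|.
  by move=> sab rab; rewrite -!hdE// HM.
have fC s : s \in `[a, b] -> lnorm (f s) <= C_norm a b f.
  by apply: le_C_norm; exact: (primitive_bounded modw (ltW k0) fpsi).
have tg : f (t + g2) = f (t - g1) <+> hdiff (f (t + g2)) (f (t - g1)).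
  by have [] // := @hdiff_primitive _ _ _ _ _ _ _ isoX fpsi (t - g1) (t + g2);
    lra.
have avg : lnorm ((h1 + h2)^-1 **: hdiff (f (t + h2)) (f (t - h1))) <=
    2 / (h1 + h2) * C_norm a b f.
  have HE : h1 + h2 = (t + h2) - (t - h1) by ring.
  rewrite HE; apply: (lnorm_average isoX fpsi) => //; try lra.
    by apply: fC; rewrite in_itv/=; apply/andP; split; lra.
  by apply: fC; rewrite in_itv/=; apply/andP; split; lra.
set Y := _ **: _ in avg.
split.
- by exists (hdiff (f (t + g2)) (f (t - g1))).
- exact: (primitive_hderivable isoX e0 fpsi).
- rewrite (le_trans (lnorm_le _ Y))// lerD//.
  rewrite mulrC; apply: (average_dist isoX convP modw e0 fpsi M0 psiM) => //.
- rewrite hdE// (le_trans (lnorm_le _ Y))// lerD//.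
  by rewrite mulrC; apply: (value_average_dist isoX convP modw e0 fpsi M0
    psiM) => //; lra.
Qed.

End Cone.

(** * Sharpness *)

Lemma maxr0_subN (R : realDomainType) (x : R) :
  Num.max x 0 - Num.max (- x) 0 = x.
Proof. by have [?|?] := leP x 0; have [?|?] := leP (- x) 0; lra. Qed.

(** * An isometric copy of the real line *)

Section Embedding.
Context {R : realType} {X : lspaceType R}.
Hypothesis isoX : isotropic X.

(** Both (k + l) x' and k x' + l x' are inverse to (k + l) x, and isotropy cancels that element. *)
Lemma invertible_convex (x x' : X) : x <+> x' = theta ->
  convex_elements X x -> convex_elements X x'.
Proof.
move=> xx' cx k l k0 l0.
apply: (sadd_cancel isoX (z := (k + l) **: x)).
rewrite -sscaleDr saddC sscaleDr [RHS]saddC.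
rewrite -sscaleDr xx' sscale_theta cx// -saddA (saddA (l **: x)).
rewrite (saddC (l **: x)) -saddA -(sscaleDr l) xx' sscale_theta saddx0.
by rewrite -sscaleDr xx' sscale_theta.
Qed.

(** Theta always lies in the intersection, so the assumption yields another element there, which is
    divided by its norm. *)
Lemma exists_unit :
  invertible_elements X `&` convex_elements X <> [set theta] ->
  exists e e' : X, [/\ e <+> e' = theta, convex_elements X e & lnorm e = 1].
Proof.
move=> nontriv.
have [x [[[x' xx'] cx] x0]] : exists x,
    (invertible_elements X `&` convex_elements X) x /\ x <> theta.
  apply: contra_notP nontriv => none; apply/seteqP; split=> [x xE|_ ->].
    by apply: contra_notP none => x0; exists x.
  split; last by move=> k l _ _; rewrite !sscale_theta saddx0.
  by exists theta; rewrite saddx0.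
have nx : 0 < lnorm x by rewrite /lnorm mdist_gt0; apply/eqP.
have inx0 : 0 <= (lnorm x)^-1 by rewrite invr_ge0 ltW.
exists ((lnorm x)^-1 **: x), ((lnorm x)^-1 **: x'); split.
- by rewrite -sscaleDr xx' sscale_theta.
- by move=> k l k0 l0; rewrite !sscaleA mulrDl cx// mulr_ge0.
- by rewrite lnorm_scale// mulVf// gt_eqF.
Qed.

Variables (e e' : X).
Hypothesis ee' : e <+> e' = theta.
Hypothesis conve : convex_elements X e.
Hypothesis norme : lnorm e = 1.

(* The inverse of c e is c e': in a semilinear space it need not be (- c) e. *)
Definition embed (c : R) : X := Num.max c 0 **: e <+> Num.max (- c) 0 **: e'.

Let conve' : convex_elements X e' := invertible_convex ee' conve.

(** The element depends only on p - q: two such pairs differ by a common amount d, and d e + d e' =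
    theta. *)
Let combE (p q c : R) : 0 <= p -> 0 <= q -> p - q = c ->
  p **: e <+> q **: e' = embed c.
Proof.
move=> p0 q0 pqc; rewrite /embed.
have cp : 0 <= Num.max c 0 by rewrite le_max lexx orbT.
have cq : 0 <= Num.max (- c) 0 by rewrite le_max lexx orbT.
have [d [d0 pE qE]] : exists d,
    [/\ 0 <= d, p = Num.max c 0 + d & q = Num.max (- c) 0 + d].
  exists (p - Num.max c 0); have [c0|c0] := leP c 0.
    by rewrite max_l ?oppr_ge0//; split; lra.
  by rewrite max_r ?oppr_le0 ?(ltW c0)//; split; lra.
rewrite pE qE conve// conve'// -!saddA; congr (_ <+> _).
by rewrite saddC -saddA (saddC _ (d **: e)) -sscaleDr ee' sscale_theta saddx0.
Qed.

Lemma embed_convex (P : X -> X) (c : R) : convexifying P -> convex_elements X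
  (embed c).
Proof.
by move=> convP; apply: (convexD convP); apply: (convexZ convP).
Qed.

Lemma embedD (c d : R) : embed (c + d) = embed c <+> embed d.
Proof.
have m0 (x : R) : 0 <= Num.max x 0 by rewrite le_max lexx orbT.
rewrite -(@combE (Num.max c 0 + Num.max d 0) (Num.max (- c) 0 + Num.max (- d)
  0)).
- rewrite conve// conve'// /embed -!saddA; congr (_ <+> _).
  by rewrite !saddA; congr (_ <+> _); rewrite saddC.
- by rewrite addr_ge0.
- by rewrite addr_ge0.
- by rewrite opprD addrACA !maxr0_subN.
Qed.

Lemma embedZ (l c : R) : 0 <= l -> l **: embed c = embed (l * c).
Proof.
move=> l0; rewrite /embed sscaleDr !sscaleA.
by rewrite !maxr_pMr// mulr0 mulrN.
Qed.

Lemma lnorm_embed (c : R) : lnorm (embed c) = `|c|.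
Proof.
have norme' : lnorm e' = 1.
  by rewrite -norme /lnorm -(isoX e' theta e) saddC ee' sadd0x mdistC.
have [c0|c0] := leP 0 c.
  rewrite /embed max_l// max_r ?oppr_le0// sscale0 saddx0.
  by rewrite lnorm_scale// norme mulr1 ger0_norm.
rewrite /embed max_r ?(ltW c0)// max_l ?oppr_ge0 ?(ltW c0)//.
by rewrite sscale0 sadd0x lnorm_scale ?oppr_ge0 ?(ltW c0)// norme' mulr1
  ltr0_norm.
Qed.

Lemma embedB (c d : R) : embed c = embed d <+> embed (c - d).
Proof. by rewrite -embedD addrC subrK. Qed.

Lemma mdist_embed (c d : R) : mdist (embed c) (embed d) = `|c - d|.
Proof. by rewrite (mdist_hdiff isoX (embedB c d)) lnorm_embed. Qed.

Lemma hdiff_embed (c d : R) : hdiff (embed c) (embed d) = embed (c - d).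
Proof. exact: (hdiffE isoX (embedB c d)). Qed.

Variables (P : X -> X) (w : R -> R) (a b : R).
Hypothesis convP : convexifying P.
Hypothesis modw : modulus_of_continuity w.

Section EmbeddedPrimitive.
Variables (phi F : R -> R).
Hypothesis phiw : forall s t : R, `|phi s - phi t| <= w `|s - t|.
Hypothesis Fphi : forall u v m M : R, a <= u -> u <= v ->
  (forall s, u <= s <= v -> m <= phi s <= M) ->
  (v - u) * m <= F v - F u <= (v - u) * M.

(** The shift [c] normalises the starting value: F a for the comparison with an integral from a, and
    0 for reading off the derivative. *)
Lemma embed_primitive (c : R) :
  primitive a b w (fun t => embed (F t - c)) (embed \o phi).
Proof.
move=> u v au uv vb; exists (embed (F v - F u)); split.
- exact: (embed_convex _ convP).
- by rewrite -embedD; congr embed; ring.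
- move=> s /andP[us sv]; have vu0 : 0 <= v - u by rewrite subr_ge0.
  rewrite /= embedZ// mdist_embed.
  have osc r : u <= r <= v ->
      phi s - w (v - u) <= phi r <= phi s + w (v - u).
    move=> /andP[ur rv]; have : `|phi r - phi s| <= w (v - u).
      apply: (le_trans (phiw r s)); apply: (modulus_homo modw) => //.
      by rewrite ler_norml; apply/andP; split; lra.
    by rewrite ler_norml => /andP[h1 h2]; apply/andP; split; lra.
  have := Fphi au uv osc.
  by rewrite mulrBr mulrDr ler_norml => /andP[h1 h2]; apply/andP; split; lra.
Qed.

(** The X-valued integral of embed o phi and embed(F t - F a) have the same density, as P fixes the
    values of [embed], and both are theta at a. [primitive_dist] with J = 0 then identifies them. *)
Lemma embed_W1Hcone : a <= b -> W1Hcone P w a b (embed \o F).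
Proof.
move=> ab; exists 1, (embed \o F); split => //; last by move=> t _;
  rewrite sscale1.
have phiH : Hclass w a b (embed \o phi).
  by move=> s t _ _; rewrite /= mdist_embed phiw.
exists (embed (F a)), (embed \o phi); split => //;
  first exact: (embed_convex _ convP).
move=> t; rewrite in_itv/= => /andP[at_ tb].
rewrite (embedB (F t) (F a)); congr (_ <+> _); apply/esym.
apply: mdist_positivity; apply/le_anti; rewrite mdist_ge0 andbT.
have sub (A psi : R -> X) : primitive a b w A psi -> primitive a t w A psi.
  by move=> prim u v au uv vt; apply: prim => //; exact: le_trans tb.
have w0 := modulus_cvg0 modw.
have := primitive_dist w0 w0 (cvg_cst (0 : R))
  (sub _ _ (lintegral_primitive convP modw phiH))
  (sub _ _ (embed_primitive (F a))) (J := fun=> 0).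
rewrite (lintegral_point convP modw ab phiH) !subrr addr0.
have -> : embed 0 = theta.
  by rewrite /embed oppr0 maxxx !sscale0 saddx0.
rewrite mdistxx; apply => // u v au uv vt.
have /(convexifying_fix convP) Pphi := embed_convex (phi u) convP.
by rewrite /= Pphi mdistxx !mulr0 addr0.
Qed.

End EmbeddedPrimitive.

End Embedding.

(** * Extremal derivatives on the real line *)

Section Sharpness.
Context {R : realType}.
Variable w : R -> R.
Hypothesis modw : modulus_of_continuity w.

(** The increments of I are bounded above through w(k v), while the hypothesis has w(k u).
    Subadditivity bounds the gap by w(k (v - u)), an error that [small_increments] absorbs. *)
Lemma Iw_absorb (k C al : R) (G : R -> R) : 0 < k -> 0 <= al -> G 0 = 0 ->
  (forall u v, 0 <= u -> u < v -> v <= al ->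
    G v - G u <= (v - u) * (C - w (k * u))) ->
  G al <= al * C - Iw w (k * al) / k.
Proof.
move=> k0 al0 G0 GC.
pose D u := G u - u * C + Iw w (k * u) / k.
suff : D al <= D 0 by rewrite /D G0 mulr0 mul0r Iw0 mul0r; lra.
apply: (small_increments (e := fun x => 1 * w (k * x))) => //.
  by apply: modulus_scale_cvg0 => //; exact: ltW.
move=> u v u0 uv val; have {}GC := GC _ _ u0 uv val.
have v0 : 0 <= v by rewrite (le_trans u0)// ltW.
have ku0 : 0 <= k * u by rewrite mulr_ge0// ltW.
have kuv : k * u <= k * v by rewrite ler_pM2l// ltW.
have /andP[_ Ikv] := Iw_increment modw ku0 kuv.
have vu0 : 0 < v - u by rewrite subr_gt0.
have Ik : Iw w (k * v) / k - Iw w (k * u) / k <= (v - u) * w (k * v).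
  rewrite -mulrBl ler_pdivrMr// (le_trans Ikv)//.
  by have -> : (v - u) * w (k * v) * k = (k * v - k * u) * w (k * v) by ring.
have wsub : w (k * v) <= w (k * u) + w (k * (v - u)).
  rewrite -{1}(subrKC u v) mulrDr (modulus_subadditive modw)//.
  by rewrite mulr_ge0 ?ltW.
have : (v - u) * w (k * v) <= (v - u) * (w (k * u) + w (k * (v - u))).
  by rewrite ler_pM2l.
by rewrite /D; lra.
Qed.

Lemma ler_dist_min (x y x' y' B : R) : `|x - x'| <= B -> `|y - y'| <= B ->
  `|Num.min x y - Num.min x' y'| <= B.
Proof.
rewrite !ler_norml => /andP[h1 h2] /andP[h3 h4].
by have [?|?] := leP x y; have [?|?] := leP x' y'; apply/andP; split; lra.
Qed.

Lemma ler_dist_max (x y x' y' B : R) : `|x - x'| <= B -> `|y - y'| <= B ->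
  `|Num.max x y - Num.max x' y'| <= B.
Proof.
rewrite !ler_norml => /andP[h1 h2] /andP[h3 h4].
by have [?|?] := leP x y; have [?|?] := leP x' y'; apply/andP; split; lra.
Qed.

Section Profile.
Hypothesis concw : concave_on_nonneg w.
Variable c : R.
Hypothesis c0 : 0 < c.
Let k := 1 + c.

(* Chosen so that profile (c u) - profile (- u) = w((1 + c) u), which by
   concavity of w is the largest increment a modulus w allows. *)
Definition profile (x : R) : R :=
  c / k * w (k / c * Num.max x 0) - k^-1 * w (k * Num.max (- x) 0).

Let k0 : 0 < k. Proof. by rewrite addr_gt0. Qed.

Lemma profile_transport u : 0 <= u -> profile (c * u) - profile (- u) = w (k *
  u).
Proof.
move=> u0; have cu0 : 0 <= c * u by rewrite mulr_ge0// ltW.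
rewrite /profile opprK (max_l cu0) (max_l u0) !max_r ?oppr_le0// !mulr0.
rewrite (modulus0 modw) mulrA divfK ?gt_eqF//.
by rewrite /k; field; rewrite gt_eqF.
Qed.

Let homax (z z' : R) : z <= z' -> Num.max z 0 <= Num.max z' 0.
Proof. by move=> zz'; rewrite ge_max !le_max zz' lexx orbT. Qed.

Lemma profile_homo x y : x <= y -> profile x <= profile y.
Proof.
move=> xy; have m0 z : 0 <= Num.max z 0 :> R by rewrite le_max lexx orbT.
have kc0 : 0 <= k / c by rewrite divr_ge0// ltW.
apply: lerB; (apply: ler_wpM2l; first by rewrite ?divr_ge0 ?invr_ge0 ?ltW).
  by apply: (modulus_homo modw); [exact: mulr_ge0|exact/ler_wpM2l/homax].
apply: (modulus_homo modw); first by rewrite mulr_ge0// ltW.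
by apply: ler_wpM2l; [exact: ltW|apply: homax; rewrite lerN2].
Qed.

(** The positive and negative parts change by d1 and d2 with d1 + d2 = x - y. Concavity with weights
    c / k and 1 / k at the points (k / c) d1 and k d2 returns exactly w(d1 + d2). *)
Lemma profile_dist x y : `|profile x - profile y| <= w `|x - y|.
Proof.
wlog yx : x y / y <= x => [H|].
  have [/H//|/ltW/H] := leP y x.
  by rewrite distrC [`|y - x|]distrC.
rewrite !ger0_norm ?subr_ge0 ?profile_homo//.
have kn0 : k != 0 by rewrite gt_eqF.
pose d1 := Num.max x 0 - Num.max y 0.
pose d2 := Num.max (- y) 0 - Num.max (- x) 0.
have [d1_ge0 d2_ge0 d12] : [/\ 0 <= d1, 0 <= d2 & d1 + d2 = x - y].
  split; [by rewrite subr_ge0 homax|by rewrite subr_ge0 homax ?lerN2|].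
  have := maxr0_subN x; have := maxr0_subN y; rewrite /d1 /d2; lra.
have kc0 : 0 < k / c by rewrite divr_gt0.
have m0 z : 0 <= Num.max z 0 :> R by rewrite le_max lexx orbT.
have wB l p q : 0 < l -> 0 <= q -> q <= p -> w (l * p) - w (l * q) <= w (l *
  (p - q)).
  move=> l0 q0 qp; rewrite lerBlDr -{1}(subrK q p) mulrDr.
  by apply: (modulus_subadditive modw); rewrite mulr_ge0 ?subr_ge0 ?(ltW l0).
have h1 : w (k / c * Num.max x 0) - w (k / c * Num.max y 0) <= w (k / c * d1).
  by apply: wB => //; rewrite -subr_ge0.
have h2 : w (k * Num.max (- y) 0) - w (k * Num.max (- x) 0) <= w (k * d2).
  by apply: wB => //; rewrite -subr_ge0.
have lE : 1 - c / k = k^-1 by rewrite /k; field; rewrite gt_eqF.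
have := concw (s := k / c * d1) (t := k * d2) (l := c / k).
rewrite lE !mulrA divfK ?gt_eqF// mulfV ?gt_eqF// mulVf ?gt_eqF// !mul1r d12.
have l0 : 0 <= c / k by rewrite divr_ge0// ltW.
have l1 : 0 <= k^-1 by rewrite invr_ge0 ltW.
move=> /(_ (mulr_ge0 (ltW kc0) d1_ge0) (mulr_ge0 (ltW k0) d2_ge0)).
rewrite l0 -subr_ge0 lE l1 => /(_ isT).
apply: le_trans; rewrite /profile.
have := ler_wpM2l l0 h1; have := ler_wpM2l l1 h2; rewrite !mulrBr; lra.
Qed.

(** Here [V] is the extremal derivative at offset [x] from one centre of reflection, and [z] is the
    branch of the other centre. Cutting off at 0 does not exceed [y], since m >= w(k al) = profile(c
    al) - profile(- al) makes y >= 0. On the inner side z >= 0 keeps the minimum at least profile(c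
    u) - profile(c al). *)
Lemma profile_cap (m al u x z : R) : 0 <= u -> u <= al -> w (k * al) <= m ->
  let V := Num.max (m + Num.min (profile x - profile (c * al)) z) 0 in
  let y := m + profile (- u) - profile (c * al) in
  (x <= - u -> V <= y) /\ (c * u <= x -> 0 <= z -> y + w (k * u) <= V).
Proof.
move=> u0 ual wm; have tal := profile_transport (le_trans u0 ual).
have tu := profile_transport u0; split=> [xu|ux z0].
  have xy := profile_homo xu.
  have alu : profile (- al) <= profile (- u) by rewrite profile_homo// lerN2.
  rewrite ge_max; apply/andP; split; last by lra.
  by rewrite -[leRHS]addrA lerD2l ge_min lerD2r xy.
have uxy := profile_homo ux.
have cual : profile (c * u) <= profile (c * al).
  by rewrite profile_homo// ler_pM2l.
rewrite le_max; apply/orP; left; rewrite -tu.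
have -> : m + profile (- u) - profile (c * al) + (profile (c * u) - profile (-
  u))
    = m + (profile (c * u) - profile (c * al)) by ring.
by rewrite lerD2l le_min lerD2r uxy/= (le_trans _ z0)// subr_le0.
Qed.

(* The function is increasing up to p = q + c al and decreasing after it; the
   two bounds by y say that it grows by w of the distance along each reflection
   q - u |-> q + c u and q' + u |-> q' - c u. *)
Lemma exists_profile (q q' al be : R) : 0 <= al -> 0 <= be ->
  q + c * al = q' - c * be ->
  exists phi : R -> R,
  [/\ forall s s', `|phi s - phi s'| <= w `|s - s'|,
      forall s, 0 <= phi s,
      forall u, 0 <= u -> u <= al -> exists y,
        (forall s, s <= q - u -> phi s <= y) /\
        (forall s, q + c * u <= s -> s <= q + c * al -> y + w (k * u) <= phi s),
      forall u, 0 <= u -> u <= be -> exists y,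
        (forall s, q' + u <= s -> phi s <= y) /\
        (forall s, q' - c * be <= s -> s <= q' - c * u -> y + w (k * u) <= phi
          s)
    & (be <= al -> forall s, s <= q - al -> phi s <= 0) /\
      (al <= be -> forall s, q' + be <= s -> phi s <= 0)].
Proof.
move=> al0 be0 pE.
pose T1 := profile (c * al); pose T2 := profile (c * be).
(* The least height at which both branches are still nonnegative at the outer ends of their pieces;
   the branch of the longer piece is then 0 at its outer end. *)
pose m := w (k * Num.max al be).
have wal : w (k * al) <= m.
  apply: (modulus_homo modw); first by rewrite mulr_ge0// ltW.
  by rewrite ler_pM2l// le_max lexx.
have wbe : w (k * be) <= m.
  apply: (modulus_homo modw); first by rewrite mulr_ge0// ltW.
  by rewrite ler_pM2l// le_max lexx orbT.
(* Both branches are shifted to vanish at p = q + c al = q' - c be, where [phi] takes its maximum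
   [m]. *)
pose phi s := Num.max (m + Num.min (profile (s - q) - T1)
                                   (profile (q' - s) - T2)) 0.
have left u s : 0 <= u -> u <= al ->
    (s <= q - u -> phi s <= m + profile (- u) - T1) /\
    (q + c * u <= s -> s <= q + c * al ->
      m + profile (- u) - T1 + w (k * u) <= phi s).
  move=> u0 ual; have [le ge] := @profile_cap m al u (s - q)
    (profile (q' - s) - T2) u0 ual wal.
  split=> [squ|us sal]; first by apply: le; lra.
  apply: ge; first by lra.
  by rewrite subr_ge0 profile_homo//; lra.
have right u s : 0 <= u -> u <= be ->
    (q' + u <= s -> phi s <= m + profile (- u) - T2) /\
    (q' - c * be <= s -> s <= q' - c * u ->
      m + profile (- u) - T2 + w (k * u) <= phi s).
  move=> u0 ube; have [le ge] := @profile_cap m be u (q' - s)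
    (profile (s - q) - T1) u0 ube wbe.
  rewrite /phi minC; split=> [squ|us sal]; first by apply: le; lra.
  apply: ge; first by lra.
  by rewrite subr_ge0 profile_homo//; lra.
exists phi; split.
- move=> s s'.
  have distD (x y z : R) : `|z + x - (z + y)| = `|x - y|.
    by congr `|_|; ring.
  have distB (x y z : R) : `|x - z - (y - z)| = `|x - y|.
    by congr `|_|; ring.
  apply: ler_dist_max; last by rewrite subrr normr0 (modulus_ge0 modw).
  rewrite distD; apply: ler_dist_min; rewrite distB.
    by rewrite -(distB s s' q); exact: profile_dist.
  rewrite distrC; have -> : s - s' = (q' - s') - (q' - s) by ring.
  exact: profile_dist.
- by move=> s; rewrite /phi le_max lexx orbT.
- move=> u u0 ual; exists (m + profile (- u) - T1).
  by split=> s; have [] := left u s u0 ual.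
- move=> u u0 ube; exists (m + profile (- u) - T2).
  by split=> s; have [] := right u s u0 ube.
- split=> [beal|albe] s sle.
    have [/(_ sle) + _] := left al s al0 (lexx _).
    by have := profile_transport al0; rewrite /m (max_l beal) -/T1; lra.
  have [/(_ sle) + _] := right be s be0 (lexx _).
  by have := profile_transport be0; rewrite /m (max_r albe) -/T2; lra.
Qed.

(** As u grows, the left-hand side with u for al has increments of at most (v - u) (y - (y + w(k
    u))): the level [y] cancels, and [Iw_absorb] applies with C = 0. *)
Lemma transport_gain (F phi : R -> R) (lo hi q al : R) :
  0 <= al -> lo <= q - al -> q + c * al <= hi ->
  (forall u v y, lo <= u -> u <= v -> v <= hi ->
    (forall s, u <= s <= v -> y <= phi s) -> (v - u) * y <= F v - F u) ->
  (forall u v y, lo <= u -> u <= v -> v <= hi ->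
    (forall s, u <= s <= v -> phi s <= y) -> F v - F u <= (v - u) * y) ->
  (forall u, 0 <= u -> u <= al -> exists y,
    (forall s, s <= q - u -> phi s <= y) /\
    (forall s, q + c * u <= s -> s <= q + c * al -> y + w (k * u) <= phi s)) ->
  F q - F (q - al) - c^-1 * (F (q + c * al) - F q) <= - (Iw w (k * al) / k).
Proof.
move=> al0 lo_q q_hi Flow Fup sides.
have := @Iw_absorb k 0 al
  (fun u => F q - F (q - u) - c^-1 * (F (q + c * u) - F q)) k0 al0.
rewrite mulr0 subr0 mulr0 addr0 !subrr mulr0 subrr sub0r; apply => //.
move=> u v u0 uv val; rewrite sub0r.
have cuv : c * u <= c * v by rewrite ler_pM2l// ltW.
have cval : c * v <= c * al by rewrite ler_pM2l.
have cu0 : 0 <= c * u by rewrite mulr_ge0// ltW.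
have [y [ylo yhi]] := sides u u0 (le_trans (ltW uv) val).
have i1 : F (q - u) - F (q - v) <= (q - u - (q - v)) * y.
  by apply: Fup; [lra|lra|lra|move=> s /andP[_ /ylo]].
have i2 : (q + c * v - (q + c * u)) * (y + w (k * u)) <=
    F (q + c * v) - F (q + c * u).
  apply: Flow; [lra|lra|lra|move=> s /andP[us sv]].
  by apply: yhi => //; lra.
have i3 : (v - u) * (y + w (k * u)) <= c^-1 * (F (q + c * v) - F (q + c * u)).
  rewrite ler_pdivlMl// (le_trans _ i2)// le_eqVlt; apply/orP; left.
  by apply/eqP; ring.
have -> : (v - u) * - w (k * u) =
  (q - u - (q - v)) * y - (v - u) * (y + w (k * u)) by ring.
by move: i1 i3; clear; lra.
Qed.

(** Obtained by reflection: - F(- x) has the derivative phi(- x). *)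
Lemma transport_gain_right (F phi : R -> R) (lo hi q al : R) :
  0 <= al -> lo <= q - c * al -> q + al <= hi ->
  (forall u v y, lo <= u -> u <= v -> v <= hi ->
    (forall s, u <= s <= v -> y <= phi s) -> (v - u) * y <= F v - F u) ->
  (forall u v y, lo <= u -> u <= v -> v <= hi ->
    (forall s, u <= s <= v -> phi s <= y) -> F v - F u <= (v - u) * y) ->
  (forall u, 0 <= u -> u <= al -> exists y,
    (forall s, q + u <= s -> phi s <= y) /\
    (forall s, q - c * al <= s -> s <= q - c * u -> y + w (k * u) <= phi s)) ->
  F (q + al) - F q - c^-1 * (F q - F (q - c * al)) <= - (Iw w (k * al) / k).
Proof.
move=> al0 lo_q q_hi Flow Fup sides.
have := @transport_gain (fun x =>
  - F (- x)) (phi \o -%R) (- hi) (- lo) (- q) al al0.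
have -> : - (- q - al) = q + al by ring.
have -> : - (- q + c * al) = q - c * al by ring.
have -> : - F (- - q) - - F (q + al) - c^-1 * (- F (q - c * al) - - F (- - q)) =
    F (q + al) - F q - c^-1 * (F q - F (q - c * al)) by rewrite opprK; ring.
have itvN (u v s : R) : (u <= - s <= v) = (- v <= s <= - u).
  by rewrite lerNr lerNl andbC.
apply; [lra|lra| | |].
- move=> u v y lou uv vhi yphi.
  have -> : v - u = - u - - v by ring.
  have -> : - F (- v) - - F (- u) = F (- u) - F (- v) by ring.
  apply: Flow; [lra|lra|lra|move=> s].
  by rewrite -itvN => /yphi; rewrite /= opprK.
- move=> u v y lou uv vhi yphi.
  have -> : v - u = - u - - v by ring.
  have -> : - F (- v) - - F (- u) = F (- u) - F (- v) by ring.
  apply: Fup; [lra|lra|lra|move=> s].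
  by rewrite -itvN => /yphi; rewrite /= opprK.
- move=> u u0 ual; have [y [ylo yhi]] := sides u u0 ual; exists y; split.
    by move=> s squ; apply: ylo; lra.
  by move=> s us sal; apply: yhi; lra.
Qed.

End Profile.

End Sharpness.

(** * Equality cases *)

Section SharpInequalities.
Context {R : realType} {X : lspaceType R}.
Variables (P : X -> X) (w : R -> R) (a b : R).
Hypothesis isoX : isotropic X.
Hypothesis nontrivX : invertible_elements X `&` convex_elements X <> [set
  theta].
Hypothesis convP : convexifying P.
Hypothesis modw : modulus_of_continuity w.
Hypothesis w_neq0 : exists2 s, 0 <= s & w s != 0.
Hypothesis ab : a < b.

Lemma exists_extremal (phi : R -> R) :
  (forall s t : R, `|phi s - phi t| <= w `|s - t|) ->
  (forall s, 0 <= phi s) ->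
  (exists s t, [/\ s \in `[a, b], t \in `[a, b] & phi s != phi t]) ->
  exists (f : R -> X) (F : R -> R),
  [/\ W1Hcone P w a b f,
      omega_norm w a b (hderiv a b f) != 0 /\
        omega_norm w a b (hderiv a b f) <= 1,
      C_norm a b f <= (F b - F a) / 2,
      (forall t, t \in `[a, b] -> lnorm (hderiv a b f t) = phi t) /\
      (forall u v, lnorm (hdiff (f v) (f u)) = `|F v - F u|) &
      (forall u v m : R, a <= u -> u <= v ->
        (forall s, u <= s <= v -> m <= phi s) -> (v - u) * m <= F v - F u) /\
      (forall u v M : R, a <= u -> u <= v ->
        (forall s, u <= s <= v -> phi s <= M) -> F v - F u <= (v - u) * M)].
Proof.
have [e [e' [ee' conve norme]]] := exists_unit nontrivX.
move=> phiw phi0 [s0 [t0 [s0ab t0ab st0]]].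
have cphi := modulus_bound_continuous modw phiw.
pose F1 t := \int[lebesgue_measure]_(s in `[a, t]) phi s.
(* Subtracting half the total gives F a = - F b, so that a monotone F has C-norm equal to half its
   increment. *)
pose F t := F1 t - F1 b / 2.
have FE u v : F v - F u = F1 v - F1 u by rewrite /F; ring.
have Fphi (u v m M : R) : a <= u -> u <= v ->
    (forall s, u <= s <= v -> m <= phi s <= M) ->
    (v - u) * m <= F v - F u <= (v - u) * M.
  move=> au uv mM; rewrite FE Rintegral_increment//.
  exact: Rintegral_bounds.
have F1a : F1 a = 0 by rewrite /F1 set_itv1 Rintegral_set1.
have cone := embed_W1Hcone isoX ee' conve norme convP modw phiw Fphi (ltW ab).
have prim : primitive a b w (embed e e' \o F) (embed e e' \o phi).
  have := embed_primitive isoX ee' conve norme convP modw phiw Fphi 0.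
  by under eq_fun do rewrite subr0; exact.
have w0 := modulus_cvg0 modw.
have hdE := hderivE isoX w0 prim ab.
have [|M0 M1 HM] := @omega_normP _ _ w a b modw w_neq0 ab
  (hderiv a b (embed e e' \o F)) 1.
  by move=> s t sab tab; rewrite !hdE//= (mdist_embed isoX ee' conve norme)
    mul1r phiw.
(* Supplies the opposite bound required by [Fphi], so that one-sided bounds on [phi] suffice
   below. *)
have osc u v s : u <= s <= v -> phi u - w (v - u) <= phi s <= phi u + w (v - u).
  move=> /andP[us sv]; have : `|phi s - phi u| <= w (v - u).
    rewrite (le_trans (phiw _ _))// (modulus_homo modw)// ger0_norm ?subr_ge0//.
    by rewrite lerB.
  by rewrite ler_norml => /andP[h1 h2]; apply/andP; split; lra.
have Flow u v m : a <= u -> u <= v -> (forall s, u <= s <= v -> m <= phi s) ->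
    (v - u) * m <= F v - F u.
  move=> au uv mphi.
  have /andP[//] : (v - u) * m <= F v - F u <= (v - u) * (phi u + w (v - u)).
  apply: Fphi => // s usv; rewrite mphi//.
  by have /andP[] := osc _ _ _ usv.
have Fup u v M : a <= u -> u <= v -> (forall s, u <= s <= v -> phi s <= M) ->
    F v - F u <= (v - u) * M.
  move=> au uv phiM.
  have /andP[//] : (v - u) * (phi u - w (v - u)) <= F v - F u <= (v - u) * M.
  apply: Fphi => // s usv; rewrite phiM// andbT.
  by have /andP[] := osc _ _ _ usv.
exists (embed e e' \o F), F; split => //.
- split => //; apply: contraNneq st0 => M_eq0.
  have := HM _ _ s0ab t0ab; rewrite M_eq0 mul0r !hdE//= (mdist_embed isoX ee'
    conve norme).
  by rewrite normr_le0 subr_eq0.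
- apply: C_norm_le => // t; rewrite in_itv/= => /andP[at_ tb].
  have Fmono u v : a <= u -> u <= v -> F u <= F v.
    move=> au uv; rewrite -subr_ge0.
    by have := Flow u v 0 au uv (fun s _ => phi0 s); rewrite mulr0.
  have FN : F a = - F b by rewrite /F F1a; field.
  have := Fmono a t (lexx a) at_; have := Fmono t b at_ tb.
  rewrite /= (lnorm_embed isoX ee' norme) FN => h1 h2; rewrite ler_norml.
  by apply/andP; split; lra.
- split=> [t tab|u v]; first by rewrite hdE//= (lnorm_embed isoX ee' norme)
  ger0_norm.
  by rewrite /= (hdiff_embed isoX ee' conve) (lnorm_embed isoX ee' norme).
Qed.

(** The peak w(h) - w(|s - t|), cut off at 0, falls from t as fast as [w] permits; its integral over
    the large interval is (h1 + h2) w(h) - I(h1) - I(h2). Any part of [a, b] outside the large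
    interval is at distance at least h from t, where the peak is 0. *)
Lemma derivative_sharp (t h1 h2 h : R) : t \in `[a, b] -> 0 < h ->
  h1 = Num.min h (t - a) -> h2 = Num.min h (b - t) ->
  exists f : R -> X,
    [/\ W1Hcone P w a b f, omega_norm w a b (hderiv a b f) != 0
      & lnorm (hderiv a b f t) =
          (Iw w h1 + Iw w h2) / (h1 + h2) * omega_norm w a b (hderiv a b f) +
          2 / (h1 + h2) * C_norm a b f].
Proof.
move=> tab h0 h1E h2E; have := tab; rewrite in_itv/= => /andP[at_ tb].
have [h1_ge0 h1h ath1 h1P] :
    [/\ 0 <= h1, h1 <= h, a <= t - h1 & h1 = h \/ t - h1 = a].
  by rewrite h1E; have [?|?] := leP h (t - a); split; lra.
have [h2_ge0 h2h th2b h2P] :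
    [/\ 0 <= h2, h2 <= h, t + h2 <= b & h2 = h \/ t + h2 = b].
  by rewrite h2E; have [?|?] := leP h (b - t); split; lra.
have H0 : 0 < h1 + h2 by have := ab; case: h1P => ?; case: h2P => ?; lra.
have wh0 : 0 < w h by exact: modulus_gt0.
pose phi s := Num.max (w h - w `|s - t|) 0.
have phi_ge0 s : 0 <= phi s by rewrite /phi le_max lexx orbT.
have phi_t : phi t = w h.
  by rewrite /phi subrr normr0 (modulus0 modw) subr0 max_l// ltW.
have phi_le u s : 0 <= u -> u <= h -> u <= `|s - t| -> phi s <= w h - w u.
  move=> u0 uh us; rewrite /phi ge_max lerD2l lerN2 subr_ge0.
  by rewrite !(modulus_homo modw).
have phiw s r : `|phi s - phi r| <= w `|s - r|.
  apply: ler_dist_max; last by rewrite subrr normr0 (modulus_ge0 modw).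
  rewrite opprB addrC -addrA addKr distrC.
  by apply: (modulus_comp_dist modw); rewrite opprB addrA subrK.
have [s0 s0ab s0t] : exists2 s0, s0 \in `[a, b] & s0 != t.
  have [->|ta] := eqVneq t a; last first.
    by exists a; rewrite 1?eq_sym// in_itv/= lexx ltW.
  by exists b; rewrite ?gt_eqF// in_itv/= lexx ltW.
have [|f [F [cone [M_neq0 M1] C_le [hd _] [_ Fup]]]] :=
    exists_extremal phiw phi_ge0.
  exists t, s0; split => //; rewrite phi_t gt_eqF// /phi gt_max wh0 andbT.
  by rewrite gtrBl modulus_gt0// normr_gt0 subr_eq0.
exists f; split => //; apply/le_anti/andP; split.
  by have [] := cone_inequalities convP modw isoX w_neq0 ab tab
    h1_ge0 h2_ge0 (lexx _) (lexx _) H0 ath1 th2b cone.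
have L1 : F t - F (t - h1) <= h1 * w h - Iw w h1.
  have := @Iw_absorb _ w modw 1 (w h) h1 (fun u => F t - F (t - u)).
  rewrite !mul1r divr1; apply => //; first by rewrite subr0 subrr.
  move=> u v u0 uv vh1; rewrite mul1r.
  have -> : F t - F (t - v) - (F t - F (t - u)) = F (t - u) - F (t - v) by ring.
  have -> : v - u = (t - u) - (t - v) by ring.
  apply: Fup; try lra.
  move=> s /andP[vs su]; apply: phi_le => //; first lra.
  by rewrite ler0_norm; lra.
have L2 : F (t + h2) - F t <= h2 * w h - Iw w h2.
  have := @Iw_absorb _ w modw 1 (w h) h2 (fun u => F (t + u) - F t).
  rewrite !mul1r divr1; apply => //; first by rewrite addr0 subrr.
  move=> u v u0 uv vh2; rewrite mul1r.
  have -> : F (t + v) - F t - (F (t + u) - F t) = F (t + v) - F (t + u) by ring.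
  have -> : v - u = (t + v) - (t + u) by ring.
  apply: Fup; try lra.
  move=> s /andP[us sv]; apply: phi_le => //; first lra.
  by rewrite ger0_norm; lra.
have L0 : F (t - h1) - F a <= 0.
  case: h1P => [h1_h|->]; last by rewrite subrr.
  rewrite -(mulr0 (t - h1 - a)); apply: Fup => // s /andP[as_ sth].
  rewrite -(subrr (w h)); apply: phi_le => //; first exact: ltW.
  by rewrite ler0_norm; lra.
have L3 : F b - F (t + h2) <= 0.
  case: h2P => [h2_h|->]; last by rewrite subrr.
  rewrite -(mulr0 (b - (t + h2))); apply: Fup => //; first lra.
  move=> s /andP[ths sb].
  rewrite -(subrr (w h)); apply: phi_le => //; first exact: ltW.
  by rewrite ger0_norm; lra.
rewrite hd// phi_t.
have I0 : 0 <= (Iw w h1 + Iw w h2) / (h1 + h2).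
  by rewrite divr_ge0// addr_ge0// Iw_ge0.
apply: (@le_trans _ _ ((Iw w h1 + Iw w h2) / (h1 + h2) * 1 +
    2 / (h1 + h2) * ((F b - F a) / 2))).
  by apply: lerD; apply: ler_wpM2l => //; rewrite divr_ge0// ltW.
have -> : (Iw w h1 + Iw w h2) / (h1 + h2) * 1 +
    2 / (h1 + h2) * ((F b - F a) / 2) =
    (Iw w h1 + Iw w h2 + (F b - F a)) / (h1 + h2).
  by field; rewrite gt_eqF.
rewrite ler_pdivrMr// mulrDr; lra.
Qed.

(** With the small interval equal to [a, b] the term K is 0, and equality only asks that |F b - F a|
    be twice the C-norm. A nonnegative, nonconstant derivative in the class achieves this; w(|s -
    a|) is one. *)
Lemma full_interval_sharp (t g1 g2 : R) : t \in `[a, b] -> 0 < g1 + g2 ->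
  0 <= g1 -> 0 <= g2 -> t - g1 = a -> t + g2 = b ->
  exists f : R -> X,
    [/\ W1Hcone P w a b f, omega_norm w a b (hderiv a b f) != 0
      & lnorm (divided_diff g1 g2 f t) =
          Kw w g1 g2 g1 g2 * omega_norm w a b (hderiv a b f) +
          2 / (g1 + g2) * C_norm a b f].
Proof.
move=> tab G0 g1_ge0 g2_ge0 tg1 tg2.
pose phi s := w `|s - a|.
have phiw s r : `|phi s - phi r| <= w `|s - r|.
  by apply: (modulus_comp_dist modw); rewrite opprB addrA subrK.
have phi_ge0 s : 0 <= phi s by apply: (modulus_ge0 modw).
have [|f [F [cone [M_neq0 M1] C_le [_ hd] _]]] :=
    exists_extremal phiw phi_ge0.
  exists b, a; rewrite !in_itv/= !lexx ltW//; split => //.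
  rewrite /phi subrr normr0 (modulus0 modw) gt_eqF// modulus_gt0//.
  by rewrite normr_gt0 subr_eq0 gt_eqF.
exists f; split => //; apply/le_anti/andP; split.
  have at1 : a <= t - g1 by rewrite tg1.
  have tb2 : t + g2 <= b by rewrite tg2.
  by have [] := cone_inequalities convP modw isoX w_neq0 ab tab
    g1_ge0 g2_ge0 (lexx _) (lexx _) G0 at1 tb2 cone.
have -> : Kw w g1 g2 g1 g2 = 0 by rewrite /Kw !subrr addr0 !mul0r.
have Gi0 : 0 <= (g1 + g2)^-1 by rewrite invr_ge0 ltW.
rewrite mul0r add0r /divided_diff tg1 tg2 (lnorm_scale _ Gi0) hd.
rewrite mulrAC mulrC ler_wpM2l// (le_trans _ (ler_norm _))//.
by rewrite mulrC -ler_pdivlMr.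
Qed.

Hypothesis concw : concave_on_nonneg w.

(** The two alternatives say that on each side the large interval reaches the end of [a, b] or the
    excess is the longer one. In the latter case the extremal derivative vanishes beyond the large
    interval on that side. *)
Lemma mean_sharp (t g1 g2 h1 h2 : R) : t \in `[a, b] ->
  0 <= g1 -> 0 <= g2 -> g1 <= h1 -> g2 <= h2 -> 0 < g1 + g2 ->
  a <= t - h1 -> t + h2 <= b -> 0 < (h1 - g1) + (h2 - g2) ->
  t - h1 = a \/ h2 - g2 <= h1 - g1 -> t + h2 = b \/ h1 - g1 <= h2 - g2 ->
  exists f : R -> X,
    [/\ W1Hcone P w a b f, omega_norm w a b (hderiv a b f) != 0
      & lnorm (divided_diff g1 g2 f t) =
          Kw w g1 g2 h1 h2 * omega_norm w a b (hderiv a b f) +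
          2 / (h1 + h2) * C_norm a b f].
Proof.
move=> tab g1_ge0 g2_ge0 gh1 gh2 G0 ath1 th2b r0 leftP rightP.
set al := h1 - g1 in r0 leftP rightP; set be := h2 - g2 in r0 leftP rightP.
set G := g1 + g2 in G0; set r := al + be in r0.
have al0 : 0 <= al by rewrite subr_ge0.
have be0 : 0 <= be by rewrite subr_ge0.
have HE : h1 + h2 = G + r by rewrite /G /r /al /be; ring.
pose c := G / r; have c0 : 0 < c by rewrite divr_gt0.
pose k := 1 + c; have k0 : 0 < k by rewrite addr_gt0.
pose q := t - g1; pose q' := t + g2.
have cr : c * al + c * be = G by rewrite -mulrDr /c divfK// gt_eqF.
pose p := q + c * al.
have pE : p = q' - c * be by rewrite /p /q /q'; move: cr; rewrite /G; lra.
have cal0 : 0 <= c * al by rewrite mulr_ge0// ltW.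
have cbe0 : 0 <= c * be by rewrite mulr_ge0// ltW.
have qal : q - al = t - h1 by rewrite /q /al; ring.
have qbe : q' + be = t + h2 by rewrite /q' /be; ring.
have [phi [phiw phi_ge0 left right [zl zr]]] :=
  exists_profile modw concw c0 al0 be0 pE.
have [|f [F [cone [M_neq0 M1] C_le [_ hd] [Flow Fup]]]] :=
    exists_extremal phiw phi_ge0.
  have p_ab : p \in `[a, b].
    by rewrite in_itv/=; apply/andP; split; [rewrite /p|rewrite pE]; lra.
  have neq s y (d : R) : 0 < d -> phi s <= y -> y + w (k * d) <= phi p ->
      phi p != phi s.
    move=> d0 sy yp; rewrite gt_eqF// (le_lt_trans sy)// (lt_le_trans _ yp)//.
    by rewrite ltrDl modulus_gt0// mulr_gt0.
  (* As r > 0, one of the two excess pieces is nondegenerate, and [phi] differs between [p] and its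
     outer end. *)
  have [al1|al_le0] := ltP 0 al.
    exists p, (q - al); split => //.
      by rewrite qal in_itv/=; apply/andP; split; lra.
    have [y [ylo yhi]] := left al al0 (lexx _).
    exact: (neq _ y al al1 (ylo _ (lexx _)) (yhi _ (lexx _) (lexx _))).
  have be1 : 0 < be by move: r0; rewrite /r; lra.
  exists p, (q' + be); split => //.
    by rewrite qbe in_itv/=; apply/andP; split; lra.
  have [y [ylo yhi]] := right be be0 (lexx _).
  apply: (neq _ y be be1 (ylo _ (lexx _))).
  by rewrite pE; apply: yhi.
exists f; split => //; apply/le_anti/andP; split.
  by have [] := cone_inequalities convP modw isoX w_neq0 ab tab
    g1_ge0 g2_ge0 gh1 gh2 G0 ath1 th2b cone.
have lo_q : a <= q - al by rewrite qal.
have q_hi : q' + be <= b by rewrite qbe.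
have L1 : F q - F (q - al) - c^-1 * (F p - F q) <= - (Iw w (k * al) / k).
  apply: (transport_gain (lo := a) (hi := q + c * al) modw c0 al0) left => //.
  - by move=> u v y au uv _; exact: Flow.
  - by move=> u v y au uv _; exact: Fup.
have L2 : F (q' + be) - F q' - c^-1 * (F q' - F p) <= - (Iw w (k * be) / k).
  rewrite pE.
  apply: (transport_gain_right (lo := a) (hi := b) modw c0 be0) right => //.
  - by rewrite -pE /p; lra.
  - by move=> u v y au uv _; exact: Flow.
  - by move=> u v y au uv _; exact: Fup.
have L0 : F (q - al) - F a <= 0.
  case: leftP => [|beal]; first by rewrite -qal => ->; rewrite subrr.
  rewrite -(mulr0 (q - al - a)); apply: Fup => // s /andP[_].
  exact: zl.
have L3 : F b - F (q' + be) <= 0.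
  case: rightP => [|albe]; first by rewrite -qbe => ->; rewrite subrr.
  rewrite -(mulr0 (b - (q' + be))); apply: Fup => //; first by rewrite /q'; lra.
  by move=> s /andP[+ _]; exact: zr.
have H0 : 0 < h1 + h2 by rewrite HE addr_gt0.
have kE : k = (h1 + h2) / r by rewrite HE mulrDl divff ?gt_eqF// addrC.
have KE : Kw w g1 g2 h1 h2 =
    (h1 + h2)^-1 * ((Iw w (k * al) + Iw w (k * be)) / k).
  rewrite /Kw -/al -/be -/r kE [_ / r * al]mulrAC [_ / r * be]mulrAC.
  by field; rewrite !gt_eqF.
have K0 : 0 <= Kw w g1 g2 h1 h2.
  rewrite KE mulr_ge0 ?invr_ge0 ?(ltW H0)// divr_ge0 ?(ltW k0)//.
  by rewrite addr_ge0// Iw_ge0// mulr_ge0// ltW.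
apply: (@le_trans _ _ (Kw w g1 g2 h1 h2 * 1 +
    2 / (h1 + h2) * ((F b - F a) / 2))).
  by apply: lerD; apply: ler_wpM2l => //; rewrite divr_ge0// ltW.
have Gi0 : 0 <= G^-1 by rewrite invr_ge0 ltW.
rewrite /divided_diff -/G (lnorm_scale _ Gi0) hd.
apply: (@le_trans _ _ (G^-1 * (F q' - F q))); last first.
  by rewrite ler_wpM2l// ler_norm.
(* The terms F p cancel between the two gains, leaving F q' - F q divided by c, and the factor 1 + 1
   / c is H / G. *)
have tot : F b - F a + (Iw w (k * al) + Iw w (k * be)) / k <=
    (1 + c^-1) * (F q' - F q) by move: L0 L1 L2 L3; clear; lra.
have -> : Kw w g1 g2 h1 h2 * 1 + 2 / (h1 + h2) * ((F b - F a) / 2) =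
    (h1 + h2)^-1 * (F b - F a + (Iw w (k * al) + Iw w (k * be)) / k).
  by rewrite KE; field; rewrite !gt_eqF.
have -> : G^-1 = (h1 + h2)^-1 * (1 + c^-1).
  rewrite /c HE; field; rewrite !gt_eqF//; exact: addr_gt0.
by rewrite -mulrA ler_wpM2l// invr_ge0 ltW.
Qed.

End SharpInequalities.

Theorem theorem8 (R : realType) (X : lspaceType R) (P : X -> X) (w : R -> R)
    (a b : R)
    (isoX : isotropic X)
    (nontrivX : invertible_elements X `&` convex_elements X <> [set theta])
    (convP : convexifying P)
    (modw : modulus_of_continuity w)
    (w_neq0 : exists2 s, 0 <= s & w s != 0)
    (ab : a < b) :
  [/\ forall (t g1 g2 h1 h2 : R) (f : R -> X),
        t \in `[a, b] ->
        0 <= g1 -> 0 <= g2 -> 0 <= h1 -> 0 <= h2 ->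
        0 < g1 + g2 -> 0 < h1 + h2 ->
        [set` `[t - g1, t + g2]] `<=` [set` `[t - h1, t + h2]] ->
        [set` `[t - h1, t + h2]] `<=` [set` `[a, b]] ->
        W1Hcone P w a b f ->
        [/\ hdiff_exists (f (t + g2)) (f (t - g1)),
            hderivable a b f,
            lnorm (divided_diff g1 g2 f t) <=
              Kw w g1 g2 h1 h2 * omega_norm w a b (hderiv a b f) +
              2 / (h1 + h2) * C_norm a b f
          & lnorm (hderiv a b f t) <=
              (Iw w h1 + Iw w h2) / (h1 + h2) *
                omega_norm w a b (hderiv a b f) +
              2 / (h1 + h2) * C_norm a b f],
      concave_on_nonneg w ->
      forall t g h : R, t \in `[a, b] -> 0 < g -> g < h ->
        let g1 := Num.min g (t - a) in
        let g2 := Num.min g (b - t) in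
        let h1 := Num.min h (t - a) in
        let h2 := Num.min h (b - t) in
        exists f : R -> X,
          [/\ W1Hcone P w a b f,
              omega_norm w a b (hderiv a b f) != 0
            & lnorm (divided_diff g1 g2 f t) =
                Kw w g1 g2 h1 h2 * omega_norm w a b (hderiv a b f) +
                2 / (h1 + h2) * C_norm a b f]
    & forall t h : R, t \in `[a, b] -> 0 < h ->
        let h1 := Num.min h (t - a) in
        let h2 := Num.min h (b - t) in
        exists f : R -> X,
          [/\ W1Hcone P w a b f,
              omega_norm w a b (hderiv a b f) != 0
            & lnorm (hderiv a b f t) =
                (Iw w h1 + Iw w h2) / (h1 + h2) *
                  omega_norm w a b (hderiv a b f) +
                2 / (h1 + h2) * C_norm a b f]].
Proof.
split.
- move=> t g1 g2 h1 h2 f tab g1_ge0 g2_ge0 h1_ge0 h2_ge0 G0 H0 gh hab cone.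
  have [gh1 gh2] : g1 <= h1 /\ g2 <= h2.
    have := gh (t - g1); have := gh (t + g2).
    rewrite /= !in_itv/= !lexx !andbT => h h'.
    have /h/andP[_ ?] : t - g1 <= t + g2 by lra.
    have /h'/andP[? _] : t - g1 <= t + g2 by lra.
    by split; lra.
  have [ath1 th2b] : a <= t - h1 /\ t + h2 <= b.
    have := hab (t - h1); have := hab (t + h2).
    rewrite /= !in_itv/= !lexx !andbT => h h'.
    have /h/andP[_ ?] : t - h1 <= t + h2 by lra.
    by have /h'/andP[? _] : t - h1 <= t + h2 by lra.
  exact: (cone_inequalities convP modw isoX w_neq0 ab).
- move=> concw t g h tab g0 gh g1 g2 h1 h2.
  have := tab; rewrite in_itv/= => /andP[at_ tb].
  have hg0 : 0 < h - g by rewrite subr_gt0.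
  (* Truncation at an end point can only shorten an excess, whose full length is h - g. A side where
     the large interval stops short of the end therefore has the longer excess, as [mean_sharp]
     requires. *)
  have [g1_ge0 gh1 ath1 left_end] : [/\ 0 <= g1, g1 <= h1, a <= t - h1 &
      (t - h1 = a /\ h1 - g1 <= h - g) \/ h1 - g1 = h - g].
    rewrite /g1 /h1; have [?|?] := leP g (t - a); have [?|?] := leP h (t - a);
      split; lra.
  have [g2_ge0 gh2 th2b right_end] : [/\ 0 <= g2, g2 <= h2, t + h2 <= b &
      (t + h2 = b /\ h2 - g2 <= h - g) \/ h2 - g2 = h - g].
    rewrite /g2 /h2; have [?|?] := leP g (b - t); have [?|?] := leP h (b - t);
      split; lra.
  have G0 : 0 < g1 + g2.
    rewrite /g1 /g2; have [?|?] := leP g (t - a); have [?|?] := leP g (b - t);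
    have := ab; lra.
  (* No excess on either side: since h - g > 0, the large interval reaches both ends, and the small
     interval is all of [a, b]. *)
  have [r_le0|r0] := leP ((h1 - g1) + (h2 - g2)) 0.
    have <- : g1 = h1 by lra.
    have <- : g2 = h2 by lra.
    by apply: full_interval_sharp => //; [case: left_end|case: right_end]; lra.
  apply: mean_sharp => //.
    by case: left_end => [[]|]; [left|right]; case: right_end => [[]|]; lra.
  by case: right_end => [[]|]; [left|right]; case: left_end => [[]|]; lra.
- move=> t h tab h0 h1 h2.
  exact: (derivative_sharp isoX nontrivX convP modw w_neq0 ab tab h0).
Qed.
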